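(* Suppose $K^0\in\mathbb{K}$. For any step size $0<\eta\le\frac12$, the iterates of the Gauss–Newton method $$K^{n+1}_i=K^n_i-2\eta\big(R_i+B_i^T\mathcal{E}_i(P^{K^n})B_i\big)^{-1}L_i^{K^n},\quad i\in\Omega,$$ all lie in $\mathbb{K}$ and satisfy, for all $n\ge0$, $$C(K^n)-C(K^* )\le\Big(1-\frac{2\mu}{\|\mathbf{X}^{K^*}\|_{\max}}\eta\Big)^n\big(C(K^0)-C(K^* )\big).$$
   Context: Let $N_s\ge 1$, $\Omega=\{1,\dots,N_s\}$; tuples $V=(V_1,\dots,V_{N_s})$ of matrices are combined componentwise, $\|V\|_{\max}=\max_i\|V_i\|$ (spectral norm). Markovian jump linear system: $x_{t+1}=A_{\omega(t)}x_t+B_{\omega(t)}u_t$, $A_i\in\mathbb{R}^{d\times d}$, $B_i\in\mathbb{R}^{d\times k}$; $\{\omega(t)\}$ is a time-homogeneous Markov chain on $\Omega$ with transition probabilities $p_{ij}$ and initial distribution $\pi$ with $\pi_i>0$; $x_0$ is random, independent of the chain, with $\mathbb{E}[x_0x_0^T]\succ0$. The system is mean-square stabilizable. $Q=(Q_i)\succ0$, $R=(R_i)\succ0$. For $K=(K_i)$, $K_i\in\mathbb{R}^{k\times d}$, $u_t=-K_{\omega(t)}x_t$ and $C(K)=\mathbb{E}[\sum_{t\ge0}x_t^TQ_{\omega(t)}x_t+u_t^TR_{\omega(t)}u_t]$. $\mathbb{K}$ is the set of $K$ making the closed loop $x_{t+1}=\Gamma_{\omega(t)}x_t$, $\Gamma_i=A_i-B_iK_i$,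 mean-square stable (equivalently $C(K)<\infty$). $K^*$ is the optimal gain minimizing $C$ over $\mathbb{K}$. $\mathcal{E}_i(V)=\sum_jp_{ij}V_j$; $\mathcal{T}_j(V)=\sum_ip_{ij}\Gamma_iV_i\Gamma_i^T$. For $K\in\mathbb{K}$: $P^K$ solves $P_i^K=Q_i+K_i^TR_iK_i+\Gamma_i^T\mathcal{E}_i(P^K)\Gamma_i$; $L_i^K=(R_i+B_i^T\mathcal{E}_i(P^K)B_i)K_i-B_i^T\mathcal{E}_i(P^K)A_i$; $X_i(0)=\mathbb{E}[x_0x_0^T\mathbf{1}\{\omega(0)=i\}]$, $\mathbf{X}^K=\sum_{t\ge0}\mathcal{T}^t(X(0))$. $\mu=\min_i\pi_i\,\sigma_{\min}(\mathbb{E}[x_0x_0^T])$. *)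

(* Defs.v *)
From HB Require Import structures.
From Stdlib Require Import ClassicalEpsilon.
From mathcomp Require Import all_boot all_order all_algebra.
From mathcomp Require Import all_classical all_reals all_analysis.
Set Implicit Arguments.
Unset Strict Implicit.
Unset Printing Implicit Defensive.
Import Order.TTheory GRing.Theory Num.Theory.
Import numFieldNormedType.Exports.
Local Open Scope classical_set_scope.
Local Open Scope ring_scope.

Section MJLS.
Context {R : realType} {Ns d k : nat}.

Definition gain := 'I_Ns -> 'M[R]_(k, d).
Definition mtuple := 'I_Ns -> 'M[R]_d.

Definition enorm n (v : 'cV[R]_n) : R := Num.sqrt (\sum_a v a 0 ^+ 2).
Definition specnorm m n (M : 'M[R]_(m, n)) : R :=
  sup [set enorm (M *m v) | v in [set v : 'cV[R]_n | enorm v = 1]].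
Definition sigma_min m n (M : 'M[R]_(m, n)) : R :=
  inf [set enorm (M *m v) | v in [set v : 'cV[R]_n | enorm v = 1]].
Definition maxnorm (V : mtuple) : R := \big[Num.max/0]_i specnorm (V i).

Definition posdef n (M : 'M[R]_n) : Prop :=
  M^T = M /\ forall v : 'cV[R]_n, v != 0 -> 0 < (v^T *m M *m v) 0 0.

Variables (A : 'I_Ns -> 'M[R]_d) (B : 'I_Ns -> 'M[R]_(d, k))
  (p : 'I_Ns -> 'I_Ns -> R) (Q : 'I_Ns -> 'M[R]_d) (Rc : 'I_Ns -> 'M[R]_k).

Definition Gam (K : gain) (i : 'I_Ns) : 'M[R]_d := A i - B i *m K i.
Definition Eop (V : mtuple) (i : 'I_Ns) : 'M[R]_d := \sum_j p i j *: V j.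
Definition Top (K : gain) (V : mtuple) : mtuple :=
  fun j => \sum_i p i j *: (Gam K i *m V i *m (Gam K i)^T).

Definition lyap_sol (K : gain) (P : mtuple) : Prop :=
  forall i, P i = Q i + (K i)^T *m Rc i *m K i + (Gam K i)^T *m Eop P i *m Gam K i.
(** P^K : the (for K in the stabilizing set, unique) solution *)
Definition PK (K : gain) : mtuple :=
  epsilon (inhabits (fun _ => 0)) (lyap_sol K).
Definition LK (K : gain) (i : 'I_Ns) : 'M[R]_(k, d) :=
  (Rc i + (B i)^T *m Eop (PK K) i *m B i) *m K i - (B i)^T *m Eop (PK K) i *m A i.

Fixpoint GN (eta : R) (K0 : gain) (n : nat) : gain :=
  match n with
  | 0%N => K0
  | n'.+1 => fun i => GN eta K0 n' i - (2 * eta) *: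
        (invmx (Rc i + (B i)^T *m Eop (PK (GN eta K0 n')) i *m B i)
           *m LK (GN eta K0 n') i)
  end.

Variables (dT : measure_display) (T : measurableType dT) (P : probability T R)
  (omega : nat -> T -> 'I_Ns) (x0 : T -> 'cV[R]_d).

Fixpoint state (K : gain) (t : nat) (w : T) : 'cV[R]_d :=
  match t with
  | 0%N => x0 w
  | t'.+1 => Gam K (omega t' w) *m state K t' w
  end.

Definition input (K : gain) (t : nat) (w : T) : 'cV[R]_k :=
  - (K (omega t w) *m state K t w).

Definition stage_cost (K : gain) (t : nat) (w : T) : R :=
  ((state K t w)^T *m Q (omega t w) *m state K t w) 0 0
  + ((input K t w)^T *m Rc (omega t w) *m input K t w) 0 0.

Definition cost (K : gain) : \bar R :=
  (\int[P]_w (\sum_(t <oo) (stage_cost K t w)%:E))%E.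

(** the set of mean-square stabilizing gains, characterised (as in the paper)
    by C(K) < oo *)
Definition Kset : set gain := [set K | (cost K < +oo)%E].

Definition Sigma0 : 'M[R]_d :=
  \matrix_(a, b) fine (\int[P]_w (x0 w a 0 * x0 w b 0)%:E)%E.
Definition X0 : mtuple := fun i =>
  \matrix_(a, b) fine (\int[P]_w (x0 w a 0 * x0 w b 0 * (omega 0%N w == i)%:R)%:E)%E.

Definition XK (K : gain) : mtuple := fun i =>
  \matrix_(a, b) limn (series (fun t => iter t (Top K) X0 i a b)).

Definition cyl (n : nat) (s : nat -> 'I_Ns) : set T :=
  [set w | forall t, (t <= n)%N -> omega t w = s t].

End MJLS.

(* Main.v *)
Require Import Defs.
From HB Require Import structures.
From Stdlib Require Import ClassicalEpsilon.
From mathcomp Require Import all_boot all_order all_algebra.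
From mathcomp Require Import all_classical all_reals all_analysis.
From mathcomp Require Import measurable_realfun ring lra.
Import Order.TTheory GRing.Theory Num.Theory.
Import numFieldNormedType.Exports.
Local Open Scope classical_set_scope.
Local Open Scope ring_scope.

(** Averaging over the chain and over [x0] turns the cost into the numerical
    series [C(K) = sum_t J (F_K^t W_K)], where [F_K V i = Gam_i^T E_i(V) Gam_i]
    is the adjoint of [T], [W_K = Q + K^T R K] and
    [J V = sum_i pi_i tr (Sigma0 V_i)].  Since [W_K] and [Sigma0] are positive
    definite, convergence of this scalar series dominates every orbit
    [F_K^t V] entrywise; so for stabilizing [K] the Lyapunov equation has
    exactly one solution [P^K], and [C(K) = J (P^K)].

    For any gain [K'], with [D = K' - K] and [G = R + B^T E(P^K) B],
    [W_K' + F_K' P^K - P^K = D^T L + L^T D + D^T G D], and iterating [F_K']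
    bounds [C(K')] against [C(K)].  The Gauss-Newton step
    [D = - 2 eta G^-1 L] makes the right-hand side
    [- 4 eta (1 - eta) L^T G^-1 L]: thus [P^K] is a supersolution for [K'],
    which gives both stability and a decrease of at least
    [2 eta mu sum_i tr (L_i^T G_i^-1 L_i)].  For [K' = Kst], completing the
    square bounds the right-hand side below by [- L^T G^-1 L], whence
    [C(K) - C(Kst) <= ||X^Kst|| sum_i tr (L_i^T G_i^-1 L_i)]. *)

Set Implicit Arguments.
Unset Strict Implicit.
Unset Printing Implicit Defensive.

(** * Quadratic forms *)

Section QuadraticForms.
Context {R : realType}.
Implicit Types (m n : nat).

Definition bform m n (M : 'M[R]_(m, n)) (u : 'cV_m) (v : 'cV_n) : R :=
  (u^T *m M *m v) 0 0.
(* Symmetry is not part of [psd]. *)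
Definition psd n (M : 'M[R]_n) := forall v, 0 <= bform M v v.
(** The squared norm keeps later estimates polynomial, free of the square root in [enorm]. *)
Definition sqnorm n (v : 'cV[R]_n) : R := \sum_a v a 0 ^+ 2.

Lemma bformE m n (M : 'M[R]_(m, n)) u v :
  bform M u v = \sum_a \sum_b M a b * (u a 0 * v b 0).
Proof.
rewrite /bform mxE exchange_big /=; apply: eq_bigr => b _.
by rewrite mxE big_distrl /=; apply: eq_bigr => a _; rewrite mxE; ring.
Qed.

Lemma bform_delta m n (M : 'M[R]_(m, n)) a b :
  bform M (delta_mx a 0) (delta_mx b 0) = M a b.
Proof. by rewrite /bform trmx_delta -rowE -colE !mxE. Qed.

(** Turns a matrix identity into a scalar one between bilinear forms, where bilinearity and [ring]
    replace noncommutative rewriting. *)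
Lemma mx_bform_inj m n (M N : 'M[R]_(m, n)) : (forall u v, bform M u v = bform N u v) -> M = N.
Proof. by move=> h; apply/matrixP => a b; rewrite -!bform_delta. Qed.

Lemma bformD m n (M N : 'M[R]_(m, n)) u v : bform (M + N) u v = bform M u v + bform N u v.
Proof. by rewrite /bform mulmxDr mulmxDl mxE. Qed.

Lemma bformZ m n c (M : 'M[R]_(m, n)) u v : bform (c *: M) u v = c * bform M u v.
Proof. by rewrite /bform -scalemxAr -scalemxAl mxE. Qed.

Lemma bformN m n (M : 'M[R]_(m, n)) u v : bform (- M) u v = - bform M u v.
Proof. by rewrite -scaleN1r bformZ mulN1r. Qed.

Lemma bformB m n (M N : 'M[R]_(m, n)) u v : bform (M - N) u v = bform M u v - bform N u v.
Proof. by rewrite bformD bformN. Qed.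

Lemma bform0 m n u v : bform (0 : 'M[R]_(m, n)) u v = 0.
Proof. by rewrite /bform mulmx0 mul0mx mxE. Qed.

Lemma bform_sum m n I (r : seq I) (P : pred I) (F : I -> 'M[R]_(m, n)) u v :
  bform (\sum_(i <- r | P i) F i) u v = \sum_(i <- r | P i) bform (F i) u v.
Proof. by apply: (big_morph (fun M => bform M u v)) => [M N|]; rewrite (bformD, bform0). Qed.

Lemma bformDl m n (M : 'M[R]_(m, n)) u u' v : bform M (u + u') v = bform M u v + bform M u' v.
Proof. by rewrite /bform linearD /= !mulmxDl mxE. Qed.

Lemma bformDr m n (M : 'M[R]_(m, n)) u v v' : bform M u (v + v') = bform M u v + bform M u v'.
Proof. by rewrite /bform mulmxDr mxE. Qed.

Lemma bformZl m n c (M : 'M[R]_(m, n)) u v : bform M (c *: u) v = c * bform M u v.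
Proof. by rewrite /bform linearZ /= -!scalemxAl mxE. Qed.

Lemma bformZr m n c (M : 'M[R]_(m, n)) u v : bform M u (c *: v) = c * bform M u v.
Proof. by rewrite /bform -scalemxAr mxE. Qed.

Lemma bform_opp m n (M : 'M[R]_(m, n)) u v : bform M (- u) (- v) = bform M u v.
Proof. by rewrite -(scaleN1r u) -(scaleN1r v) bformZl bformZr !mulN1r opprK. Qed.

Lemma bform_vec0 m n (M : 'M[R]_(m, n)) u : bform M u 0 = 0.
Proof. by rewrite /bform mulmx0 mxE. Qed.

Lemma bform_mul m n m' n' (A : 'M[R]_(m, m')) (M : 'M[R]_(m, n)) (B : 'M[R]_(n, n')) u v :
  bform (A^T *m M *m B) u v = bform M (A *m u) (B *m v).
Proof. by rewrite /bform trmx_mul !mulmxA. Qed.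

Lemma bform_mull m n q (M : 'M[R]_(m, n)) (C : 'M[R]_(m, q)) u v :
  bform (C^T *m M) u v = bform M (C *m u) v.
Proof. by rewrite -[C^T *m M]mulmx1 bform_mul mul1mx. Qed.

Lemma bform_mulr m n q (M : 'M[R]_(m, n)) (C : 'M[R]_(n, q)) u v :
  bform (M *m C) u v = bform M u (C *m v).
Proof. by rewrite /bform !mulmxA. Qed.

Lemma bform_tr m n (M : 'M[R]_(m, n)) u v : bform M^T u v = bform M v u.
Proof.
rewrite /bform; have -> : u^T *m M^T *m v = (v^T *m M *m u)^T.
  by rewrite !trmx_mul trmxK mulmxA.
by rewrite mxE.
Qed.

Lemma bform_trmul m n q (M : 'M[R]_(m, n)) (C : 'M[R]_(m, q)) u v :
  bform (M^T *m C) u v = bform M (C *m v) u.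
Proof. by rewrite -bform_tr trmx_mul trmxK bform_mull. Qed.

Lemma bform_rank1 m n (a u : 'cV[R]_m) (b v : 'cV[R]_n) :
  bform (a *m b^T) u v = (u^T *m a) 0 0 * (b^T *m v) 0 0.
Proof.
rewrite /bform (_ : _ *m v = (u^T *m a) *m (b^T *m v)); last by rewrite !mulmxA.
by rewrite mxE big_ord1.
Qed.

Lemma bform1 n u v : bform (1%:M : 'M[R]_n) u v = (u^T *m v) 0 0.
Proof. by rewrite /bform mulmx1. Qed.

Lemma bform1E n (v : 'cV[R]_n) : bform 1%:M v v = sqnorm v.
Proof. by rewrite bform1 mxE; apply: eq_bigr => a _; rewrite mxE expr2. Qed.

Lemma bform_gram n (M : 'M[R]_n) v : bform (M^T *m M) v v = sqnorm (M *m v).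
Proof. by rewrite -[M^T]mulmx1 bform_mul bform1E. Qed.

Lemma sqnorm_ge0 n (v : 'cV[R]_n) : 0 <= sqnorm v.
Proof. by apply: sumr_ge0 => a _; exact: sqr_ge0. Qed.

Lemma sqnorm_eq0 n (v : 'cV[R]_n) : (sqnorm v == 0) = (v == 0).
Proof.
apply/eqP/eqP => [v0|->]; last first.
  by rewrite /sqnorm big1 // => a _; rewrite mxE expr0n.
apply/matrixP => a b; rewrite ord1 mxE; apply/eqP; rewrite -sqrf_eq0; apply/eqP.
apply: (psumr_eq0P _ v0) => // i _; exact: sqr_ge0.
Qed.

Lemma sqnorm0 n : sqnorm (0 : 'cV[R]_n) = 0.
Proof. by apply/eqP; rewrite sqnorm_eq0. Qed.

Lemma sqnormZ n c (v : 'cV[R]_n) : sqnorm (c *: v) = c ^+ 2 * sqnorm v.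
Proof. by rewrite /sqnorm mulr_sumr; apply: eq_bigr => a _; rewrite mxE exprMn. Qed.

Lemma enorm_sq n (v : 'cV[R]_n) : enorm v ^+ 2 = sqnorm v.
Proof. by rewrite sqr_sqrtr // sqnorm_ge0. Qed.

Lemma enorm_ge0 n (v : 'cV[R]_n) : 0 <= enorm v.
Proof. exact: sqrtr_ge0. Qed.

Lemma enorm1 n (v : 'cV[R]_n) : enorm v = 1 <-> sqnorm v = 1.
Proof.
split=> [v1|]; first by rewrite -enorm_sq v1 expr1n.
by rewrite /enorm -/(sqnorm v) => ->; rewrite sqrtr1.
Qed.

Lemma normalize n (v : 'cV[R]_n) : v != 0 ->
  exists2 u, sqnorm u = 1 & v = enorm v *: u.
Proof.
move=> v0; have nv : enorm v != 0.
  by apply: contra v0; rewrite -sqnorm_eq0 -enorm_sq => /eqP ->; rewrite expr0n.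
exists ((enorm v)^-1 *: v).
  by rewrite sqnormZ -enorm_sq -exprMn mulVf // expr1n.
by rewrite scalerA divff // scale1r.
Qed.

(** * Positive semidefinite and positive definite matrices *)

Lemma psd_add n (M N : 'M[R]_n) : psd M -> psd N -> psd (M + N).
Proof. by move=> hM hN v; rewrite bformD addr_ge0. Qed.

Lemma psd_scale n c (M : 'M[R]_n) : 0 <= c -> psd M -> psd (c *: M).
Proof. by move=> c0 hM v; rewrite bformZ mulr_ge0. Qed.

Lemma psd_sum n I (r : seq I) (P : pred I) (F : I -> 'M[R]_n) :
  (forall i, psd (F i)) -> psd (\sum_(i <- r | P i) F i).
Proof. by move=> hF v; rewrite bform_sum; apply: sumr_ge0 => i _; exact: hF. Qed.

Lemma psd_congr n m (M : 'M[R]_n) (A : 'M[R]_(n, m)) : psd M -> psd (A^T *m M *m A).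
Proof. by move=> hM v; rewrite bform_mul. Qed.

Lemma posdef_psd n (M : 'M[R]_n) : posdef M -> psd M.
Proof.
move=> [_ hM] v; have [->|v0] := eqVneq v 0; last exact/ltW/hM.
by rewrite /bform mulmx0 mxE.
Qed.

(** A negative [c] would make the trinomial negative for large [t]. If [c = 0], a nonzero [b] leaves
    an affine function taking negative values; if [c > 0], the minimizer [- b / c] gives the
    inequality. *)
Lemma quadratic_discriminant (a b c : R) :
  (forall t, 0 <= a + 2 * t * b + t ^+ 2 * c) -> b ^+ 2 <= a * c.
Proof.
move=> h; have c0 : 0 <= c.
  rewrite leNgt; apply/negP => c0.
  have [t ht] : exists t, t * c <= - (1 + `|a| + 2 * `|b|) /\ 1 <= t.
    (* The quotient makes [t * c] outweigh [1 + |a| + 2 |b|]; the leading 1 ensures [1 <= t], so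
       that the term [t ^+ 2 * c] dominates the other two. *)
    exists (1 + (1 + `|a| + 2 * `|b|) / - c).
    have hq : 0 <= (1 + `|a| + 2 * `|b|) / - c.
      by apply: divr_ge0; [rewrite !addr_ge0 // mulr_ge0|rewrite oppr_ge0 ltW].
    split; last by rewrite lerDl.
    rewrite mulrDl mul1r invrN mulrN mulNr divfK ?lt_eqF //; lra.
  have := h t; have /ler_normlP[? ?] := lexx `|a|; have /ler_normlP[? ?] := lexx `|b|.
  nra.
have [c0'|cn0] := eqVneq c 0.
  rewrite c0' mulr0; have [->|b0] := eqVneq b 0; first by rewrite expr0n.
  (* At this point the affine function equals -1. *)
  have := h (- (a + 1) / (2 * b)); rewrite c0' mulr0 addr0.
  have -> : a + 2 * (- (a + 1) / (2 * b)) * b = -1 by field.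
  by rewrite oppr_ge0 ler10.
have cp : 0 < c by rewrite lt_neqAle eq_sym cn0.
have := h (- b / c).
have -> : a + 2 * (- b / c) * b + (- b / c) ^+ 2 * c = (a * c - b ^+ 2) / c by field.
by rewrite pmulr_lge0 ?invr_gt0 // subr_ge0.
Qed.

Lemma psd_cauchy_schwarz n (M : 'M[R]_n) u v : M^T = M -> psd M ->
  bform M u v ^+ 2 <= bform M u u * bform M v v.
Proof.
move=> sM hM; apply: quadratic_discriminant => t.
have := hM (u + t *: v); rewrite !(bformDl, bformDr, bformZl, bformZr).
rewrite -[bform M v u]bform_tr sM; congr (_ <= _); ring.
Qed.

Lemma psd_sqnorm n : psd (1%:M : 'M[R]_n).
Proof. by move=> v; rewrite bform1E sqnorm_ge0. Qed.

(** The entrywise l1 norm is crude but explicit; the bounds built on it need just some finite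
    constant. *)
Definition mxabs m n (M : 'M[R]_(m, n)) : R := \sum_a \sum_b `|M a b|.

Lemma mxabs_ge0 m n (M : 'M[R]_(m, n)) : 0 <= mxabs M.
Proof. by apply: sumr_ge0 => a _; apply: sumr_ge0. Qed.

Lemma bform_le_mxabs m n (M : 'M[R]_(m, n)) u v :
  `|bform M u v| <= mxabs M * (sqnorm u + sqnorm v).
Proof.
rewrite bformE (le_trans (ler_norm_sum _ _ _)) // mulr_suml ler_sum // => a _.
rewrite (le_trans (ler_norm_sum _ _ _)) // mulr_suml ler_sum // => b _.
rewrite normrM ler_wpM2l // normrM.
have hu : `|u a 0| ^+ 2 <= sqnorm u.
  rewrite /sqnorm (bigD1 a) //= real_normK ?num_real // lerDl.
  by apply: sumr_ge0 => i _; exact: sqr_ge0.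
have hv : `|v b 0| ^+ 2 <= sqnorm v.
  rewrite /sqnorm (bigD1 b) //= real_normK ?num_real // lerDl.
  by apply: sumr_ge0 => i _; exact: sqr_ge0.
have := normr_ge0 (u a 0); have := normr_ge0 (v b 0); nra.
Qed.

Lemma sqnorm_mul_le n (M : 'M[R]_n) :
  exists2 C, 0 <= C & forall v, sqnorm (M *m v) <= C * sqnorm v.
Proof.
exists (mxabs (M^T *m M) * 2); first by rewrite mulr_ge0 ?mxabs_ge0.
move=> v; rewrite -bform_gram (le_trans (ler_norm _)) //.
by rewrite (le_trans (bform_le_mxabs _ _ _)) // -mulrA ler_wpM2l ?mxabs_ge0 //; lra.
Qed.

(** Cauchy-Schwarz for [M] at [M *m v] and [v] bounds the square of [|Mv|^2] by a multiple of
    [|Mv|^2] times the form at [v]; one factor [|Mv|^2] cancels. *)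
Lemma psd_sqnorm_mul n (M : 'M[R]_n) : M^T = M -> psd M ->
  exists2 C, 0 <= C & forall v, sqnorm (M *m v) <= C * bform M v v.
Proof.
move=> sM hM.
exists (mxabs M * 2) => [|v]; first by rewrite mulr_ge0 ?mxabs_ge0.
have E : bform M (M *m v) v = sqnorm (M *m v).
  by rewrite -bform1E bform1 /bform -mulmxA.
have := psd_cauchy_schwarz (M *m v) v sM hM; rewrite E.
have := le_trans (ler_norm _) (bform_le_mxabs M (M *m v) (M *m v)).
have := sqnorm_ge0 (M *m v); have := hM v; have := mxabs_ge0 M.
set s := sqnorm _; set q := bform M v v; set b := bform _ _ _.
move=> h1 h2 h3 h4 h5.
have [->|s0] := eqVneq s 0; first by rewrite !mulr_ge0.
have sp : 0 < s by rewrite lt_neqAle eq_sym s0.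
rewrite -(ler_pM2l sp) -expr2 (le_trans h5) //.
by rewrite (_ : s * _ = (mxabs M * (s + s)) * q) ?ler_wpM2r //; ring.
Qed.

(** A row [w] of the left kernel satisfies [w M w^T = 0], hence vanishes by definiteness. *)
Lemma posdef_unit n (M : 'M[R]_n) : posdef M -> M \in unitmx.
Proof.
move=> [sM hM]; rewrite -row_free_unit -kermx_eq0; apply/eqP/row_matrixP => i.
rewrite row0; set w := row i _.
have hw : w *m M = 0 by rewrite -row_mul mulmx_ker row0.
apply: trmx_inj; rewrite trmx0; apply/eqP; apply: contraT => w0.
by have := hM _ w0; rewrite trmxK hw mul0mx mxE ltxx.
Qed.

(** Avoids eigenvalues and compactness: [v] is recovered from [M *m v] by the inverse, so
    [|v|^2 <= D |Mv|^2 <= D C v^T M v]. Adding 1 to [D * C] keeps the constant invertible. *)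
Lemma posdef_ge n (M : 'M[R]_n) : posdef M ->
  exists2 c, 0 < c & forall v, c * sqnorm v <= bform M v v.
Proof.
move=> pM; have uM := posdef_unit pM; have hM := posdef_psd pM.
have [C C0 hC] := psd_sqnorm_mul pM.1 hM.
have [D D0 hD] := sqnorm_mul_le (invmx M).
have p : 0 < D * C + 1 by rewrite ltr_wpDl ?mulr_ge0.
exists (D * C + 1)^-1 => [|v]; first by rewrite invr_gt0.
rewrite mulrC ler_pdivrMr //.
have := hD (M *m v); rewrite mulmxA mulVmx // mul1mx => h.
have := hC v; have := hM v; nra.
Qed.

Lemma posdef_inv n (M : 'M[R]_n) : posdef M -> posdef (invmx M).
Proof.
move=> pM; have uM := posdef_unit pM; have [sM hM] := pM; split.
  by rewrite trmx_inv sM.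
move=> v v0; have := hM (invmx M *m v).
rewrite trmx_mul trmx_inv sM !mulmxA mulmxKV //; apply.
by apply: contra v0 => /eqP h; rewrite -[v]mul1mx -(mulmxV uM) -mulmxA h mulmx0.
Qed.

(* Pivoting: each step clears one more diagonal entry. *)
Lemma psd_sum_rank1 n (M : 'M[R]_n) : M^T = M -> psd M ->
  exists s : seq 'cV[R]_n, M = \sum_(w <- s) w *m w^T.
Proof.
have [N] := ubnP #|[pred i | M i i != 0]|; elim: N M => // N IH M lN sM hM.
have hD (M' : 'M[R]_n) : psd M' -> forall i, 0 <= M' i i.
  by move=> h i; rewrite -bform_delta.
have [i /= iM|z] := pickP [pred i | M i i != 0]; last first.
  exists [::]; rewrite big_nil; apply/matrixP => a b; rewrite mxE.
  have /negbFE/eqP za := z a.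
  (* With a zero diagonal, Cauchy-Schwarz on basis vectors makes every entry vanish. *)
  have := psd_cauchy_schwarz (delta_mx a 0) (delta_mx b 0) sM hM.
  by rewrite !bform_delta za mul0r real_exprn_even_le0 ?num_real // => /eqP.
have Mi : 0 < M i i by rewrite lt_neqAle eq_sym iM hD.
pose w : 'cV[R]_n := (Num.sqrt (M i i))^-1 *: (M *m delta_mx i 0).
have wwE : w *m w^T = (M i i)^-1 *: (M *m delta_mx i 0 *m (M *m (delta_mx i 0 : 'cV[R]_n))^T).
  rewrite /w linearZ /= -scalemxAl -scalemxAr scalerA -expr2 exprVn sqr_sqrtr //.
  exact: ltW.
have bw v : bform (w *m w^T) v v = (M i i)^-1 * bform M v (delta_mx i 0) ^+ 2.
  rewrite wwE bformZ bform_rank1 expr2 mulmxA -/(bform _ _ _); congr (_ * (_ * _)).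
  by rewrite trmx_mul -/(bform _ _ _) bform_tr.
pose M' := M - w *m w^T.
(* The subtracted form is at most that of [M], by Cauchy-Schwarz against the pivot basis vector. *)
have hM' : psd M'.
  move=> v; rewrite bformB bw subr_ge0 ler_pdivrMl //.
  rewrite -(bform_delta M i i) mulrC; exact: psd_cauchy_schwarz.
have sM' : M'^T = M' by rewrite linearB /= sM trmx_mul trmxK.
have M'E a : M' a a = M a a - (M i i)^-1 * M a i ^+ 2.
  by rewrite -(bform_delta M' a a) bformB bw !bform_delta.
have [|s hs] := IH M' _ sM' hM'.
  rewrite -ltnS (leq_trans _ lN) // ltnS; apply: proper_card.
  apply/properP; split.
    apply/fintype.subsetP => a; rewrite !inE; apply: contra => /eqP za.
    rewrite eq_le hD // andbT -za -subr_ge0 M'E opprB addrC subrK.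
    by rewrite mulr_ge0 ?sqr_ge0 // invr_ge0 ltW.
  exists i; first by rewrite inE iM.
  rewrite inE negbK M'E expr2 mulKf // subrr //.
by exists (w :: s); rewrite big_cons -hs addrC subrK.
Qed.

(** * Trace inequalities and singular values *)

Lemma mxtrace_rank1 n (M : 'M[R]_n) w : \tr (M *m (w *m w^T)) = bform M w w.
Proof. by rewrite mulmxA mxtrace_mulC mulmxA /mxtrace big_ord1. Qed.

(** Writing [N] as a sum of matrices [w w^T] turns the trace into a sum of values [w^T M w]. *)
Lemma tr_psd_ge0 n (M N : 'M[R]_n) : psd M -> N^T = N -> psd N -> 0 <= \tr (M *m N).
Proof.
move=> hM sN hN; have [s ->] := psd_sum_rank1 sN hN.
by rewrite mulmx_sumr linear_sum /= sumr_ge0 // => w _; rewrite mxtrace_rank1.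
Qed.

Lemma tr_mul_le n (X M : 'M[R]_n) c :
  (forall v, bform X v v <= c * sqnorm v) -> M^T = M -> psd M ->
  \tr (X *m M) <= c * \tr M.
Proof.
move=> hX sM hM; rewrite -subr_ge0.
have -> : c * \tr M - \tr (X *m M) = \tr ((c%:M - X) *m M).
  by rewrite mulmxBl linearB /= mul_scalar_mx mxtraceZ.
apply: tr_psd_ge0 => // v.
by rewrite bformB -[c%:M]scalemx1 bformZ bform1E subr_ge0.
Qed.

Lemma tr_mul_ge n (X M : 'M[R]_n) c :
  (forall v, c * sqnorm v <= bform X v v) -> M^T = M -> psd M ->
  c * \tr M <= \tr (X *m M).
Proof.
move=> hX sM hM; rewrite -lerN2 -mulNr -linearN -mulNmx; apply: tr_mul_le => // v.
by rewrite bformN mulNr lerN2.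
Qed.

Lemma sigma_min_le n (S : 'M[R]_n) v : sqnorm v = 1 -> sigma_min S <= enorm (S *m v).
Proof.
move=> v1; apply: ge_inf; last by exists v => //; exact/enorm1.
by exists 0 => _ [u _ <-]; exact: enorm_ge0.
Qed.

Lemma sigma_min_ge0 n (S : 'M[R]_n) : 0 <= sigma_min S.
Proof.
rewrite /sigma_min; set X := [set _ | _ in _].
have [->|/set0P X0] := eqVneq X set0; first by rewrite inf0.
by apply: lb_le_inf => // _ [u _ <-]; exact: enorm_ge0.
Qed.

(** Let [l] be the infimum of the form on the unit sphere and [N = S - l I], which is [psd]. On unit
    vectors [|Sv|^2 - l^2] is at most a constant times the form of [N], which comes arbitrarily
    close to 0; hence [sigma_min S <= l], without the infimum being attained. *)
Lemma psd_sigma_min n (S : 'M[R]_n) v : S^T = S -> psd S ->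
  sigma_min S * sqnorm v <= bform S v v.
Proof.
move=> sS hS; have [->|/normalize[u u1 ->]] := eqVneq v 0.
  by rewrite bform_vec0 sqnorm0 mulr0.
rewrite sqnormZ u1 bformZl bformZr mulr1 mulrC mulrA -expr2.
rewrite ler_wpM2l ?sqr_ge0 //; move: u u1 => {v}.
pose Y := [set bform S v v | v in [set v | sqnorm v = 1]].
have lbY : has_lbound Y by exists 0 => _ [v _ <-].
pose l := inf Y; have hl v : sqnorm v = 1 -> l <= bform S v v.
  by move=> v1; apply: ge_inf => //; exists v.
suff sl : forall u : 'cV[R]_n, sqnorm u = 1 -> sigma_min S <= l.
  by move=> u u1; rewrite (le_trans (sl u u1)) // hl.
move=> u u1; rewrite leNgt; apply/negP => lts.
have Y0 : Y !=set0 by exists (bform S u u), u.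
have l0 : 0 <= l by apply: lb_le_inf => // _ [v _ <-].
pose N := S - l%:M.
have bN v : bform N v v = bform S v v - l * sqnorm v.
  by rewrite bformB -bform1E -[l%:M]scalemx1 bformZ.
have hN : psd N.
  move=> v; rewrite bN; have [->|/normalize[w w1 ->]] := eqVneq v 0.
    by rewrite bform_vec0 sqnorm0 mulr0 subr0.
  by rewrite sqnormZ w1 bformZl bformZr mulr1 mulrA -expr2 mulrC -mulrBl mulr_ge0 ?sqr_ge0 ?subr_ge0 ?hl.
have sN : N^T = N by rewrite linearB /= sS tr_scalar_mx.
have [C C0 hC] := psd_sqnorm_mul sN hN.
(* |Sv|^2 = |Nv|^2 + 2 l <v, Nv> + l^2 |v|^2 *)
have key v : sqnorm v = 1 -> sigma_min S ^+ 2 - l ^+ 2 <= (C + 2 * l + 1) * bform N v v.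
  move=> v1; have h1 : sigma_min S ^+ 2 <= sqnorm (S *m v).
    by rewrite -enorm_sq lerXn2r ?nnegrE ?sigma_min_ge0 ?enorm_ge0 // sigma_min_le.
  have E : sqnorm (S *m v) = sqnorm (N *m v) + 2 * l * bform N v v + l ^+ 2.
    have -> : S *m v = N *m v + l *: v by rewrite mulmxBl mul_scalar_mx subrK.
    rewrite -!bform1E !(bformDl, bformDr, bformZl, bformZr) [bform _ v v]bform1E v1.
    have -> : bform 1%:M v (N *m v) = bform N v v by rewrite bform1 /bform mulmxA.
    have -> : bform 1%:M (N *m v) v = bform N v v.
      by rewrite bform1 /bform trmx_mul sN.
    ring.
  have := hC v; have := hN v; nra.
have Cp : 0 < C + 2 * l + 1 by rewrite ltr_wpDl // addr_ge0 // mulr_ge0.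
(* This tolerance is the lower bound that [key] imposes on the form of [N], so a unit vector within
   it of the infimum is contradictory. *)
have dp : 0 < (sigma_min S ^+ 2 - l ^+ 2) / (C + 2 * l + 1).
  by rewrite divr_gt0 // subr_gt0 ltrXn2r ?nnegrE // sigma_min_ge0.
have [_ [v v1 <-]] := inf_adherent dp (conj Y0 lbY); rewrite -/l.
have := key v v1; rewrite -ler_pdivrMl // bN v1 mulr1 mulrC.
by rewrite leNgt ltrBlDl => /negP.
Qed.

(** For a unit vector, Cauchy-Schwarz gives [u^T M u <= |Mu|], and [|Mu|] lies in the set whose
    supremum is [specnorm M]. *)
Lemma bform_specnorm n (M : 'M[R]_n) v : bform M v v <= specnorm M * sqnorm v.
Proof.
have [->|/normalize[u u1 ->]] := eqVneq v 0.
  by rewrite bform_vec0 sqnorm0 mulr0.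
rewrite sqnormZ u1 bformZl bformZr mulr1 mulrA -expr2 mulrC.
rewrite ler_wpM2r ?sqr_ge0 //.
have [C C0 hC] := sqnorm_mul_le M.
have : enorm (M *m u) <= specnorm M.
  apply: ub_le_sup; last by exists u => //; exact/enorm1.
  (* [C + 1] bounds the norms because its square exceeds [C]; no square root of [C] is taken. *)
  exists (C + 1) => _ [w /enorm1 w1 <-].
  rewrite -ler_sqr ?nnegrE ?enorm_ge0 ?addr_ge0 // enorm_sq.
  by rewrite (le_trans (hC w)) // w1; nra.
apply: le_trans.
have := psd_cauchy_schwarz u (M *m u) (trmx1 _ _) (@psd_sqnorm n).
rewrite [bform _ u u]bform1E u1 mul1r bform1E -enorm_sq.
have -> : bform 1%:M u (M *m u) = bform M u u by rewrite bform1 /bform mulmxA.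
have := enorm_ge0 (M *m u); nra.
Qed.

End QuadraticForms.

(** * The cost as a deterministic series *)

Section Independence.
Context {R : realType} {d : measure_display} {T : measurableType d}.
Variables (P : probability T R) (C : set T).
Hypothesis mC : measurable C.

(** The complement of [C] is null for the restricted measure, and inside [C] the two measures
    agree. *)
Lemma ge0_integral_mrestr (f : T -> \bar R) :
  measurable_fun setT f -> (forall x, 0 <= f x)%E ->
  (\int[mrestr P mC]_x f x = \int[P]_(x in C) f x)%E.
Proof.
move=> mf f0; have mNC : measurable (~` C) by exact: measurableC.
rewrite (ge0_negligible_integral mNC) //; last by rewrite /= /mrestr setICl measure0.
rewrite setTD setCK; apply: eq_measure_integral => A mA AC.
by rewrite /= /mrestr setIidl.
Qed.

Context {d' : measure_display} {Y : measurableType d'}.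
Variable phi : T -> Y.
Hypothesis mphi : measurable_fun setT phi.
Hypothesis indep : forall E, measurable E ->
  P (phi @^-1` E `&` C) = (P (phi @^-1` E) * P C)%E.

(** Independence says that the image under [phi] of the measure restricted to [C] is [P C] times the
    image of [P]; the rest is change of variables. *)
Lemma ge0_integral_indep (f : Y -> \bar R) :
  measurable_fun setT f -> (forall y, 0 <= f y)%E ->
  (\int[P]_(x in C) f (phi x) = P C * \int[P]_x f (phi x))%E.
Proof.
move=> mf f0; have mfphi : measurable_fun setT (f \o phi) by exact: measurableT_comp.
rewrite -ge0_integral_mrestr //.
have := @ge0_integral_pushforward _ _ _ _ _ _ mphi (mrestr P mC) setT f measurableT mf.
rewrite preimage_setT => <- //.
have p0 : 0 <= fine (P C) by rewrite fine_ge0.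
rewrite (eq_measure_integral (mscale (NngNum p0) (pushforward P phi))); last first.
  move=> A mA _; rewrite /= /mscale /= /pushforward /mrestr fineK ?fin_num_measure //.
  by rewrite muleC indep.
rewrite ge0_integral_mscale //= fineK ?fin_num_measure //; congr (_ * _)%E.
by have := @ge0_integral_pushforward _ _ _ _ _ _ mphi P setT f measurableT mf; rewrite preimage_setT => ->.
Qed.

Lemma integral_indep (f : Y -> \bar R) :
  measurable_fun setT f -> P.-integrable setT (f \o phi) ->
  (\int[P]_(x in C) f (phi x) = P C * \int[P]_x f (phi x))%E.
Proof.
move=> mf intf.
change (\int[P]_(x in C) (f \o phi) x = P C * \int[P]_x (f \o phi) x)%E.
rewrite integralE [in RHS]integralE muleBr ?fin_num_measure //; last first.
  exact: integrable_add_def.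
rewrite funepos_comp funeneg_comp.
by rewrite !ge0_integral_indep //; [exact: measurable_funeneg|exact: measurable_funepos].
Qed.
End Independence.

Section Operators.
Context {R : realType} {Ns d k : nat}.
Variables (A : 'I_Ns -> 'M[R]_d) (B : 'I_Ns -> 'M[R]_(d, k)).
Variables (p : 'I_Ns -> 'I_Ns -> R) (pi : 'I_Ns -> R).
Variables (Q : 'I_Ns -> 'M[R]_d) (Rc : 'I_Ns -> 'M[R]_k) (S : 'M[R]_d).

Definition Fop (K : @gain R Ns d k) (V : @mtuple R Ns d) : @mtuple R Ns d :=
  fun i => (Gam A B K i)^T *m Eop p V i *m Gam A B K i.
Definition weight (K : @gain R Ns d k) : @mtuple R Ns d :=
  fun i => Q i + (K i)^T *m Rc i *m K i.
Definition Jcost (V : @mtuple R Ns d) : R := \sum_i pi i * \tr (S *m V i).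
End Operators.

(** * Law of the closed-loop state *)

Section Process.
Context {R : realType} {Ns d k : nat}.
Variables (A : 'I_Ns -> 'M[R]_d) (B : 'I_Ns -> 'M[R]_(d, k)).
Variables (p : 'I_Ns -> 'I_Ns -> R) (pi : 'I_Ns -> R).
Variables (Q : 'I_Ns -> 'M[R]_d) (Rc : 'I_Ns -> 'M[R]_k).
Variables (dT : measure_display) (T : measurableType dT) (P : probability T R).
Variables (omega : nat -> T -> 'I_Ns) (x0 : T -> 'cV[R]_d).
Hypothesis omega_meas : forall t i, measurable [set w | omega t w = i].
Hypothesis omega_law : forall n (s : nat -> 'I_Ns),
  P (cyl omega n s) = (pi (s 0%N) * \prod_(t < n) p (s t) (s t.+1))%:E.
Hypothesis x0_meas : forall a, measurable_fun setT (fun w => x0 w a ord0).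
Hypothesis x0_sq : forall a, (\int[P]_w ((x0 w a ord0) ^+ 2)%:E < +oo)%E.
Hypothesis x0_indep : forall (Bs : 'I_d -> set R), (forall a, measurable (Bs a)) ->
  forall n (s : nat -> 'I_Ns),
    P ([set w | forall a, Bs a (x0 w a ord0)] `&` cyl omega n s)
    = (P [set w | forall a, Bs a (x0 w a ord0)] * P (cyl omega n s))%E.

Let S := Sigma0 P x0.
Local Notation state := (state A B omega x0).
Local Notation Fop := (Fop A B p).

Lemma cyl_meas n (s : nat -> 'I_Ns) : measurable (cyl omega n s).
Proof.
rewrite (_ : cyl omega n s = \bigcap_(t in [set t | (t <= n)%N]) [set w | omega t w = s t]).
  by apply: bigcap_measurable => [|t _]; [exists 0%N|exact: omega_meas].
by apply/seteqP; split => w h t; exact: h.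
Qed.

Let cyl_fin n s : P (cyl omega n s) \is a fin_num.
Proof. by rewrite fin_num_measure //; exact: cyl_meas. Qed.

Let pair0 a b w : R * R := (x0 w a 0, x0 w b 0).

Let pair0_meas a b : measurable_fun setT (pair0 a b).
Proof. exact: measurable_fun_pair. Qed.

(** Independence is assumed on boxes, a family closed under intersection that generates the plane's
    measurable sets, so uniqueness of measures extends it. Pairs of coordinates are enough for
    quadratic forms in [x0]. *)
Lemma pair_indep a b n s (E : set (R * R)) : measurable E ->
  P (pair0 a b @^-1` E `&` cyl omega n s)
  = (P (pair0 a b @^-1` E) * P (cyl omega n s))%E.
Proof.
move=> mE; have mC := cyl_meas n s.
have p0 : 0 <= fine (P (cyl omega n s)) by rewrite fine_ge0.
have := @measure_unique _ R (R * R)%type [set X `*` Y | X in measurable & Y in measurable]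
  (fun=> setT) (measurable_prod_measurableType _ _).
move=> /(_ _ _ _ (pushforward (mrestr P mC) (pair0 a b))
  (mscale (NngNum p0) (pushforward P (pair0 a b)))).
rewrite /= /pushforward /mrestr /mscale /= fineK ?fin_num_measure // => h.
rewrite [RHS]muleC; apply: h mE.
- move=> _ _ [X mX [Y mY <-]] [X' mX' [Y' mY' <-]].
  exists (X `&` X'); first exact: measurableI.
  by exists (Y `&` Y'); [exact: measurableI|rewrite setXI].
- by move=> _; exists setT => //; exists setT => //; rewrite setXTT.
- by apply/seteqP; split => // x _; exists 0%N.
- exact: pair0_meas.
- exact: pair0_meas.
- move=> _ [X mX [Y mY <-]]; rewrite /pushforward.
  (* The intersection lets one coordinate carry both constraints when [a = b]. *)
  pose Bs c := (if c == a then X else setT) `&` (if c == b then Y else setT).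
  have -> : pair0 a b @^-1` (X `*` Y) = [set w | forall c, Bs c (x0 w c ord0)].
    apply/seteqP; split => [w [/= h1 h2] c|w /= h3].
      by split; [case: eqP => // ->|case: eqP => // ->].
    by split; [have [] := h3 a; rewrite eqxx|have [_] := h3 b; rewrite eqxx].
  rewrite x0_indep; first by rewrite muleC.
  by move=> c; apply: measurableI; case: ifP => _; rewrite ?measurableT.
- by move=> _; rewrite preimage_setT setTI -ge0_fin_numE ?fin_num_measure.
Qed.

Lemma integrable_x0x0 a b : P.-integrable setT (fun w => (x0 w a 0 * x0 w b 0)%:E).
Proof.
have sq c : P.-integrable setT (fun w => ((x0 w c 0) ^+ 2)%:E).
  apply/integrableP; split; first by apply/measurable_EFinP/measurable_funX.
  rewrite (eq_integral (fun w => ((x0 w c 0) ^+ 2)%:E)) // => w _.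
  by rewrite gee0_abs // lee_fin sqr_ge0.
have := integrableD measurableT (sq a) (sq b).
apply: le_integrable => //; first exact/measurable_EFinP/measurable_funM.
move=> w _; rewrite lee_fin.
rewrite [leRHS]ger0_norm ?addr_ge0 ?sqr_ge0 // ler_norml.
by apply/andP; split; nra.
Qed.

Lemma Sigma0E a b : (\int[P]_w (x0 w a 0 * x0 w b 0)%:E = (S a b)%:E)%E.
Proof. by rewrite mxE fineK //; apply: integrable_fin_num => //; exact: integrable_x0x0. Qed.

Lemma integral_x0x0 a b n s :
  (\int[P]_(w in cyl omega n s) (x0 w a 0 * x0 w b 0)%:E = P (cyl omega n s) * (S a b)%:E)%E.
Proof.
rewrite -Sigma0E.
apply: (@integral_indep _ _ _ P _ (cyl_meas n s) _ _ (pair0 a b) _ _ (fun y : R * R => (y.1 * y.2)%:E)) => //.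
- by move=> E; exact: pair_indep.
- by apply/measurable_EFinP/measurable_funM.
- exact: integrable_x0x0.
Qed.

Lemma integral_bform (N : 'M[R]_d) n s :
  (\int[P]_(w in cyl omega n s) (bform N (x0 w) (x0 w))%:E
   = P (cyl omega n s) * (\tr (S *m N))%:E)%E.
Proof.
have mC := cyl_meas n s.
have iC a b : P.-integrable (cyl omega n s) (fun w => (x0 w a 0 * x0 w b 0)%:E).
  by apply: (integrableS measurableT) => //; exact: integrable_x0x0.
under eq_integral => w _.
  rewrite bformE -sumEFin; under eq_bigr => a _.
    rewrite -sumEFin; under eq_bigr => b _ do rewrite EFinM.
    over.
  over.
rewrite integral_sum //; last first.
  by move=> a; apply: integrable_sum => // b _; exact: integrableZl.
under eq_bigr => a _.
  rewrite integral_sum //; last by move=> b; exact: integrableZl.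
  under eq_bigr => b _.
    rewrite integralZl // integral_x0x0 -[P _]fineK ?cyl_fin // -!EFinM.
    over.
  rewrite sumEFin; over.
rewrite sumEFin -[P _]fineK ?cyl_fin // -EFinM; congr _%:E.
rewrite /mxtrace mulr_sumr exchange_big /=; apply: eq_bigr => b _.
rewrite mxE mulr_sumr; apply: eq_bigr => a _.
by have -> : S b a = S a b; [rewrite !mxE; under eq_integral do rewrite mulrC|ring].
Qed.

(** State transition matrix along a fixed mode path: on a cylinder the state is this deterministic
    matrix applied to [x0]. *)
Fixpoint transition (K : @gain R Ns d k) (s : nat -> 'I_Ns) (m : nat) : 'M[R]_d :=
  if m is m'.+1 then Gam A B K (s m') *m transition K s m' else 1%:M.

Lemma state_transition K s m w : (forall t, (t < m)%N -> omega t w = s t) ->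
  state K m w = transition K s m *m x0 w.
Proof.
elim: m => [|m IH] h; first by rewrite mul1mx.
by rewrite /= IH ?h ?mulmxA // => t tm; apply: h; exact: ltnW.
Qed.

Definition update (s : nat -> 'I_Ns) m i : nat -> 'I_Ns :=
  fun t => if t == m then i else s t.

Lemma transition_eq K s s' m : (forall t, (t < m)%N -> s t = s' t) ->
  transition K s m = transition K s' m.
Proof.
elim: m => // m IH h; rewrite /= h // IH // => t tm; apply: h; exact: ltnW.
Qed.

Lemma cyl_update m s :
  cyl omega m s = \big[setU/set0]_(i < Ns) cyl omega m.+1 (update s m.+1 i).
Proof.
apply/seteqP; split => [w h|w].
  rewrite -bigcup_seq; exists (omega m.+1 w) => /=; first exact: mem_index_enum.
  move=> t; rewrite /update; case: eqP => [->//|] /eqP tm; rewrite leq_eqVlt (negbTE tm).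
  exact: h.
rewrite -bigcup_seq => -[i _ h] t tm; rewrite h ?(leqW tm) // /update.
by case: eqP => // E; rewrite E ltnn in tm.
Qed.

(** The Markov property on cylinders: extending a path by one mode multiplies its probability by a
    transition probability. *)
Lemma P_cyl_update m s i :
  P (cyl omega m.+1 (update s m.+1 i)) = (P (cyl omega m s) * (p (s m) i)%:E)%E.
Proof.
rewrite !omega_law -EFinM big_ord_recr /= mulrA /update /= eqxx.
rewrite (ltn_eqF (ltnSn m)).
congr (_ * _ * _)%:E; apply: eq_bigr => t _.
by rewrite eqSS !ltn_eqF // leqW.
Qed.

Lemma modefun_meas t (g : 'I_Ns -> R) : measurable_fun setT (fun w => g (omega t w)).
Proof.
rewrite (_ : (fun w => _) = fun w => \sum_i g i * \1_[set w | omega t w = i] w).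
  apply: measurable_sum => i; apply: measurable_funM => //.
apply/funext => w; rewrite (bigD1 (omega t w)) //= indicE mem_set // mulr1.
rewrite big1 ?addr0 // => i iw; rewrite indicE memNset ?mulr0 //.
by move=> /= E; rewrite E eqxx in iw.
Qed.

Lemma state_meas K t a : measurable_fun setT (fun w => state K t w a 0).
Proof.
elim: t a => [|t IH] a //=.
under eq_fun do rewrite mxE.
apply: measurable_sum => b; apply: measurable_funM => //.
exact: (modefun_meas t (fun i => Gam A B K i a b)).
Qed.

Lemma quad_meas K t (V : @mtuple R Ns d) : measurable_fun setT
  (fun w => bform (V (omega t w)) (state K t w) (state K t w)).
Proof.
under eq_fun do rewrite bformE.
apply: measurable_sum => a; apply: measurable_sum => b; apply: measurable_funM.
  exact: (modefun_meas t (fun i => V i a b)).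
by apply: measurable_funM; exact: state_meas.
Qed.

(** Backward recursion: splitting the cylinder by the next mode and summing against [p] applies
    [Fop] once. The induction on the horizon [t] keeps [m] and [s] general because each split
    lengthens the prefix. *)
Lemma integral_quad K (V : @mtuple R Ns d) t m s : (forall i, psd (V i)) ->
  (\int[P]_(w in cyl omega m s)
     (bform (V (omega (m + t) w)) (state K (m + t) w) (state K (m + t) w))%:E
   = P (cyl omega m s) *
     (\tr (S *m ((transition K s m)^T *m iter t (Fop K) V (s m) *m transition K s m)))%:E)%E.
Proof.
move=> hV; elim: t m s => [|t IH] m s.
  rewrite addn0 -integral_bform; apply: eq_integral => w /set_mem h.
  rewrite h // (@state_transition K s) ?bform_mul // => t tm; exact/h/ltnW.
rewrite [in LHS]cyl_update ge0_integral_bigsetU //=; first last.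
- move=> w _; rewrite lee_fin; exact: hV.
- apply/measurable_EFinP; apply: measurable_funS (quad_meas K (m + t.+1) V) => //.
- apply/trivIsetP => i j _ _ ij; apply/seteqP; split => // w [hi hj].
  have := hi m.+1 (leqnn _); rewrite hj // /update eqxx => E.
  by rewrite E eqxx in ij.
- exact: index_enum_uniq.
- by move=> i; exact: cyl_meas.
under eq_bigr => i _.
  rewrite -addSnnS IH P_cyl_update -muleA -[P _]fineK ?cyl_fin // -!EFinM.
  over.
rewrite sumEFin -[P _]fineK ?cyl_fin // -EFinM -mulr_sumr.
congr (_ * _)%:E; rewrite /update /= eqxx (ltn_eqF (ltnSn m)).
under eq_bigr => i _.
  rewrite (@transition_eq K _ s m); last first.
    by move=> l lm; rewrite ltn_eqF // ltnW.
  rewrite -linearZ /= scalemxAr scalemxAl scalemxAr.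
  over.
rewrite -linear_sum /=; congr mxtrace.
rewrite -mulmx_sumr; congr (_ *m _).
rewrite -mulmx_suml -mulmx_sumr /Fop /Eop trmx_mul !mulmxA; congr (_ *m _ *m _).
Qed.

Lemma stage_costE K t w : stage_cost A B Q Rc omega x0 K t w =
  bform (weight Q Rc K (omega t w)) (state K t w) (state K t w).
Proof.
rewrite /stage_cost /input bformD bform_mul; congr (_ + _).
by rewrite -/(bform _ _ _) bform_opp.
Qed.

Lemma integral_stage_cost K t : (forall i, psd (weight Q Rc K i)) ->
  (\int[P]_w (stage_cost A B Q Rc omega x0 K t w)%:E
   = (Jcost pi S (iter t (Fop K) (weight Q Rc K)))%:E)%E.
Proof.
move=> hW; under eq_integral do rewrite stage_costE.
have -> : [set: T] = \big[setU/set0]_(i < Ns) cyl omega 0 (fun=> i).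
  apply/seteqP; split => // w _; rewrite -bigcup_seq.
  by exists (omega 0%N w) => [/=|l]; [exact: mem_index_enum|rewrite leqn0 => /eqP ->].
rewrite ge0_integral_bigsetU //=; first last.
- move=> w _; rewrite lee_fin; exact: hW.
- apply/measurable_EFinP; apply: measurable_funS (quad_meas K t _) => //.
- apply/trivIsetP => i j _ _ ij; apply/seteqP; split => // w [hi hj].
  by have := hi 0%N isT; rewrite hj // => E; rewrite E eqxx in ij.
- exact: index_enum_uniq.
- by move=> i; exact: cyl_meas.
rewrite /Jcost -sumEFin; apply: eq_bigr => i _.
have := @integral_quad K _ t 0%N (fun=> i) hW; rewrite add0n => ->.
by rewrite omega_law big_ord0 mulr1 /= trmx1 mul1mx mulmx1.
Qed.

(** Stage costs are nonnegative, so sum and expectation can be exchanged. *)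
Lemma costE K : (forall i, psd (weight Q Rc K i)) ->
  (cost A B Q Rc P omega x0 K
   = \sum_(t <oo) (Jcost pi S (iter t (Fop K) (weight Q Rc K)))%:E)%E.
Proof.
move=> hW; rewrite /cost integral_nneseries //.
- by apply: eq_eseriesr => t _; exact: integral_stage_cost.
- move=> t; apply/measurable_EFinP.
  rewrite (_ : stage_cost _ _ _ _ _ _ _ _ = fun w =>
    bform (weight Q Rc K (omega t w)) (state K t w) (state K t w)).
    exact: quad_meas.
  by apply/funext => w; exact: stage_costE.
- by move=> t w _; rewrite lee_fin stage_costE; exact: hW.
Qed.

(** The event of starting in mode [i] is a cylinder of length zero, independent of [x0] and of
    probability [pi i]. *)
Lemma X0E i : X0 P omega x0 i = pi i *: S.
Proof.
apply/matrixP => a b; rewrite !mxE.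
have : (\int[P]_(w in cyl omega 0 (fun=> i)) (x0 w a 0 * x0 w b 0)%:E
  = (pi i * S a b)%:E)%E.
  by rewrite integral_x0x0 omega_law big_ord0 mulr1 EFinM.
rewrite integral_mkcond mxE => E; have := congr1 fine E => /= <-; congr fine.
apply: eq_integral => w _; rewrite patchE; case: ifPn => [/set_mem h|/negP h].
  by rewrite h // eqxx mulr1.
case: eqP => [E0|_]; last by rewrite mulr0.
by exfalso; apply: h; apply/mem_set => t; rewrite leqn0 => /eqP ->.
Qed.

End Process.

(** * Coupled Lyapunov equations *)

Section Sequences.
Context {R : realType}.

Lemma cvg_limit_eq (f : nat -> R) (l l' : R) :
  l = l' -> f n @[n --> \oo] --> l -> f n @[n --> \oo] --> l'.
Proof. by move=> ->. Qed.

Lemma cvg_sumr (I : Type) (r : seq I) (f : I -> nat -> R) (l : I -> R) :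
  (forall i, f i n @[n --> \oo] --> l i) ->
  (\sum_(i <- r) f i n) @[n --> \oo] --> \sum_(i <- r) l i.
Proof. by move=> h; apply: cvg_big => //; exact: add_continuous. Qed.

Lemma cvgMl (a : R) (f : nat -> R) (l : R) :
  f n @[n --> \oo] --> l -> (a * f n) @[n --> \oo] --> a * l.
Proof. by move=> h; apply: cvgM => //; exact: cvg_cst. Qed.

Lemma dominated_series (u v : nat -> R) (C : R) :
  (forall n, `|u n| <= C * v n) -> cvgn (series v) -> cvgn (series u).
Proof.
move=> uv cv; apply: normed_cvg; apply: (@series_le_cvg _ _ (fun n => C * v n)) => //.
- by move=> n /=.
- by move=> n; rewrite (le_trans _ (uv n)).
- have -> : series (fun n => C * v n) = fun n => C * series v n.
    by apply/funext => n; rewrite /series /= mulr_sumr.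
  by apply/cvg_ex; exists (C * limn (series v)); exact: cvgMl.
Qed.

Lemma ereal_series_cvg (u : nat -> R) : (forall n, 0 <= u n) -> cvgn (series u) ->
  (\sum_(t <oo) (u t)%:E = (limn (series u))%:E)%E.
Proof.
move=> u0 cu; rewrite -EFin_lim //; congr (limn _).
by apply/funext => n; rewrite /series /= sumEFin.
Qed.

Lemma nonneg_series_cvg (u : nat -> R) (M : R) : (forall n, 0 <= u n) ->
  (forall n, series u n <= M) -> cvgn (series u).
Proof.
move=> u0 uM; apply: nondecreasing_is_cvgn; last by exists M => _ [n _ <-].
by apply/nondecreasing_seqP => n; rewrite /series /= big_nat_recr //= lerDl.
Qed.

Lemma ereal_series_cvgP (u : nat -> R) : (forall n, 0 <= u n) ->
  (\sum_(t <oo) (u t)%:E < +oo)%E -> cvgn (series u).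
Proof.
move=> u0 fin; apply: (@nonneg_series_cvg _ (fine (\sum_(t <oo) (u t)%:E)%E)) => // n.
have s0 : (0 <= \sum_(t <oo) (u t)%:E)%E by apply: nneseries_ge0 => t _ _; rewrite lee_fin.
rewrite -lee_fin fineK; last by rewrite ge0_fin_numE.
rewrite /series /= -sumEFin; apply: (nneseries_lim_ge (P := xpredT)) => t _ _; rewrite lee_fin //.
Qed.

End Sequences.

Section Lyapunov.
Context {R : realType} {Ns d k : nat}.
Variables (A : 'I_Ns -> 'M[R]_d) (B : 'I_Ns -> 'M[R]_(d, k)).
Variables (p : 'I_Ns -> 'I_Ns -> R) (pi : 'I_Ns -> R).
Variables (Q : 'I_Ns -> 'M[R]_d) (Rc : 'I_Ns -> 'M[R]_k) (S : 'M[R]_d).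
Hypothesis p_ge0 : forall i j, 0 <= p i j.
Hypothesis pi_gt0 : forall i, 0 < pi i.
Hypothesis S_posdef : posdef S.
Hypothesis Q_posdef : forall i, posdef (Q i).
Hypothesis R_posdef : forall i, posdef (Rc i).

Local Notation tuple := (@mtuple R Ns d).
Local Notation F := (Fop A B p).
Local Notation W := (weight Q Rc).
Local Notation J := (Jcost pi S).
Implicit Types (K : @gain R Ns d k) (V D M : tuple).

Definition psdt V := forall i, psd (V i).

(** * Calculus of [Fop] and [Jcost] *)

Lemma bform_Fop K V i u v : bform (F K V i) u v =
  \sum_j p i j * bform (V j) (Gam A B K i *m u) (Gam A B K i *m v).
Proof. by rewrite bform_mul bform_sum; apply: eq_bigr => j _; rewrite bformZ. Qed.

Lemma FopD K V V' : F K (fun i => V i + V' i) = fun i => F K V i + F K V' i.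
Proof.
apply/funext => i; apply: mx_bform_inj => u v; rewrite bformD !bform_Fop -big_split /=.
by apply: eq_bigr => j _; rewrite bformD mulrDr.
Qed.

Lemma FopZ K c V : F K (fun i => c *: V i) = fun i => c *: F K V i.
Proof.
apply/funext => i; apply: mx_bform_inj => u v; rewrite bformZ !bform_Fop mulr_sumr.
by apply: eq_bigr => j _; rewrite bformZ mulrCA.
Qed.

Lemma iterFD K V V' n : iter n (F K) (fun i => V i + V' i)
  = fun i => iter n (F K) V i + iter n (F K) V' i.
Proof. by elim: n => //= n ->; exact: FopD. Qed.

Lemma iterFZ K c V n : iter n (F K) (fun i => c *: V i) = fun i => c *: iter n (F K) V i.
Proof. by elim: n => //= n ->; exact: FopZ. Qed.

Lemma iterF_psd K V n : psdt V -> psdt (iter n (F K) V).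
Proof.
move=> hV; elim: n => //= n IH i v; rewrite bform_Fop sumr_ge0 // => j _.
by rewrite mulr_ge0 //; exact: IH.
Qed.

(** Along the iterates, [F D - D] telescopes. With [M = W K] this compares any candidate [D] to the
    cost of [K] through its Lyapunov residual. *)
Lemma telescope K M D n i :
  \sum_(0 <= t < n) iter t (F K) (fun i => M i + F K D i - D i) i
  = \sum_(0 <= t < n) iter t (F K) M i + iter n (F K) D i - D i.
Proof.
elim: n => [|n IH]; first by rewrite !big_geq //= add0r subrr.
rewrite !big_nat_recr //= IH.
have -> : (fun i => M i + F K D i - D i) = (fun i => M i + F K D i + (-1) *: D i).
  by apply/funext => j; rewrite scaleN1r.
rewrite (iterFD K (fun i => M i + F K D i)) iterFD iterFZ -iterSr /= scaleN1r.
by rewrite [X in X + _ = _]addrAC [X in _ + X = _]addrC addrA addrK addrAC addrA.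
Qed.

Lemma JD V V' : J (fun i => V i + V' i) = J V + J V'.
Proof.
by rewrite /Jcost -big_split; apply: eq_bigr => i _; rewrite mulmxDr linearD mulrDr.
Qed.

Lemma JZ c V : J (fun i => c *: V i) = c * J V.
Proof.
rewrite /Jcost mulr_sumr; apply: eq_bigr => i _.
by rewrite -scalemxAr linearZ /= mulrCA.
Qed.

Lemma J_sum (U : nat -> tuple) n :
  J (fun i => \sum_(0 <= t < n) U t i) = \sum_(0 <= t < n) J (U t).
Proof.
elim: n => [|n IH].
  rewrite big_geq // /Jcost big1 // => i _; by rewrite big_geq // mulmx0 linear0 mulr0.
rewrite big_nat_recr //= -IH -JD; congr Jcost; apply/funext => i.
by rewrite big_nat_recr.
Qed.

Lemma J_telescope K M D n :
  \sum_(0 <= t < n) J (iter t (F K) (fun i => M i + F K D i - D i))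
  = \sum_(0 <= t < n) J (iter t (F K) M) + J (iter n (F K) D) - J D.
Proof.
rewrite -!J_sum -JD -mulN1r -JZ -JD; congr Jcost; apply/funext => i.
by rewrite telescope scaleN1r.
Qed.

Lemma J_ge0 V : psdt V -> 0 <= J V.
Proof.
move=> hV; apply: sumr_ge0 => i _; apply: mulr_ge0; first exact: ltW.
by rewrite mxtrace_mulC tr_psd_ge0 ?S_posdef.1 //; exact: posdef_psd.
Qed.

Lemma weight_psd K : psdt (W K).
Proof. by move=> i; apply: psd_add; [|apply: psd_congr]; exact: posdef_psd. Qed.

Lemma stage_ge0 K t : 0 <= J (iter t (F K) (W K)).
Proof. by apply: J_ge0; apply: iterF_psd; exact: weight_psd. Qed.

(* The bound holds at [t = 0] because [W K] is positive definite, and [F K] preserves it. *)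
Lemma iterF_le_weight K V : exists2 C, 0 <= C & forall t i u v,
  `|bform (iter t (F K) V i) u v|
  <= C * (bform (iter t (F K) (W K) i) u u + bform (iter t (F K) (W K) i) v v).
Proof.
have h i : exists C, 0 <= C /\ forall u v,
    `|bform (V i) u v| <= C * (bform (W K i) u u + bform (W K i) v v).
  have [c c0 hc] := posdef_ge (Q_posdef i).
  exists (mxabs (V i) / c); split=> [|u v]; first by rewrite divr_ge0 ?mxabs_ge0 // ltW.
  apply: le_trans (bform_le_mxabs _ _ _) _; rewrite -mulrA ler_wpM2l ?mxabs_ge0 //.
  rewrite ler_pdivlMl // mulrDr lerD //; apply: le_trans (hc _) _.
    by rewrite bformD lerDl; apply: psd_congr; exact: posdef_psd.
  by rewrite bformD lerDl; apply: psd_congr; exact: posdef_psd.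
have [C hC] := choice h.
exists (\sum_i C i); first by apply: sumr_ge0 => i _; have [] := hC i.
elim=> [|t IH] i u v /=.
  apply: le_trans ((hC i).2 u v) _; apply: ler_wpM2r.
    by rewrite addr_ge0 //; exact: weight_psd.
  by rewrite (bigD1 i) //= lerDl sumr_ge0 // => j _; have [] := hC j.
rewrite !bform_Fop -big_split mulr_sumr /=.
apply: le_trans (ler_norm_sum _ _ _) _; apply: ler_sum => j _.
by rewrite normrM ger0_norm // -mulrDr mulrCA ler_wpM2l.
Qed.

(** Since [S] dominates [c I] and [pi i > 0], [J V] is at least [c * pi i] times the trace of [V i].
    Summing the inverse constants makes the bound uniform in [i]. *)
Lemma diag_le_J : exists2 C, 0 <= C & forall V, psdt V -> forall i a, V i a a <= C * J V.
Proof.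
have [c c0 hc] := posdef_ge S_posdef.
have w0 i : 0 <= (c * pi i)^-1 by rewrite invr_ge0 mulr_ge0 // ltW.
exists (\sum_i (c * pi i)^-1); first by apply: sumr_ge0.
move=> V hV i a; have d0 j b : 0 <= V j b b by rewrite -bform_delta; exact: hV.
have tS j : c * \tr (V j) <= \tr (S *m V j).
  rewrite -subr_ge0 mxtrace_mulC.
  have -> : \tr (V j *m S) - c * \tr (V j) = \tr (V j *m (S - c%:M)).
    by rewrite mulmxBr linearB /= mul_mx_scalar mxtraceZ.
  apply: tr_psd_ge0 => //; first by rewrite linearB /= tr_scalar_mx S_posdef.1.
  by move=> v; rewrite bformB -[c%:M]scalemx1 bformZ bform1E subr_ge0.
have t0 j : 0 <= \tr (V j) by apply: sumr_ge0.
have h : V i a a <= (c * pi i)^-1 * J V.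
  rewrite ler_pdivlMl ?mulr_gt0 //; apply: (@le_trans _ _ (pi i * \tr (S *m V i))).
    rewrite mulrAC mulrC ler_pM2l //; apply: le_trans (tS i); rewrite ler_pM2l //.
    by rewrite /mxtrace (bigD1 a) //= lerDl; apply: sumr_ge0.
  rewrite /Jcost (bigD1 i) //= lerDl; apply: sumr_ge0 => j _.
  rewrite mulr_ge0 //; first exact: ltW.
  by rewrite (le_trans _ (tS j)) // mulr_ge0 // ltW.
apply: le_trans h _; rewrite ler_wpM2r ?J_ge0 //.
by rewrite (bigD1 i) //= lerDl; apply: sumr_ge0.
Qed.

(** The domination by the weight orbit is read at two basis vectors, whence [D + D]; a single scalar
    series then controls all entries. *)
Lemma iterF_entry_le K V : exists2 C, 0 <= C &
  forall t i a b, `|iter t (F K) V i a b| <= C * J (iter t (F K) (W K)).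
Proof.
have [C C0 hC] := iterF_le_weight K V; have [D D0 hD] := diag_le_J.
exists (C * (D + D)) => [|t i a b]; first by rewrite mulr_ge0 ?addr_ge0.
rewrite -bform_delta -mulrA; apply: le_trans (hC _ _ _ _) _; rewrite ler_wpM2l //.
by rewrite mulrDl !bform_delta lerD // hD //; apply: iterF_psd; exact: weight_psd.
Qed.

Lemma iterF_J_le K V : exists2 C, 0 <= C &
  forall t, `|J (iter t (F K) V)| <= C * J (iter t (F K) (W K)).
Proof.
have [C C0 hC] := iterF_entry_le K V.
exists (\sum_i pi i * \sum_a \sum_b (`|S a b| * C)).
  apply: sumr_ge0 => i _; apply: mulr_ge0; first exact: ltW.
  by apply: sumr_ge0 => a _; apply: sumr_ge0 => b _; rewrite mulr_ge0.
move=> t; rewrite mulr_suml; apply: le_trans (ler_norm_sum _ _ _) _.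
apply: ler_sum => i _; rewrite normrM gtr0_norm // -mulrA ler_pM2l //.
rewrite mulr_suml; apply: le_trans (ler_norm_sum _ _ _) _; apply: ler_sum => a _.
rewrite mxE mulr_suml; apply: le_trans (ler_norm_sum _ _ _) _; apply: ler_sum => b _.
by rewrite normrM -mulrA ler_wpM2l.
Qed.

(* By [costE] this is membership in [Kset]. *)
Definition stable K := cvgn (series (fun t => J (iter t (F K) (W K)))).

(** * Orbits and the solution [PK] for stable gains *)

Lemma stable_entry_series K V i a b : stable K ->
  cvgn (series (fun t => iter t (F K) V i a b)).
Proof.
by move=> sK; have [C _ hC] := iterF_entry_le K V; apply: dominated_series sK.
Qed.

Lemma stable_J_series K V : stable K -> cvgn (series (fun t => J (iter t (F K) V))).
Proof. by move=> sK; have [C _ hC] := iterF_J_le K V; apply: dominated_series sK. Qed.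

Lemma stable_entry0 K V i a b : stable K ->
  (iter t (F K) V i a b) @[t --> \oo] --> 0.
Proof. by move=> sK; apply: cvg_series_cvg_0; exact: stable_entry_series. Qed.

Lemma stable_J0 K V : stable K -> J (iter t (F K) V) @[t --> \oo] --> 0.
Proof. by move=> sK; apply: cvg_series_cvg_0; exact: stable_J_series. Qed.

Lemma Fop_entry K V i a b : F K V i a b =
  \sum_j p i j * \sum_c \sum_e (Gam A B K i c a * Gam A B K i e b) * V j c e.
Proof.
rewrite -bform_delta bform_Fop; apply: eq_bigr => j _; rewrite bformE; congr (_ * _).
apply: eq_bigr => c _; apply: eq_bigr => e _.
by rewrite -!colE !mxE mulrC.
Qed.

(** The solution is the entrywise sum of the orbit of [W K]; removing its first term leaves [F]
    applied to the sum. *)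
Lemma lyap_exists K : stable K -> exists P, lyap_sol A B p Q Rc K P.
Proof.
move=> sK; exists (fun i => \matrix_(a, b) limn (series (fun t => iter t (F K) (W K) i a b))).
move=> i; apply/matrixP => a b; rewrite -/(weight _ _ _ _) mxE [RHS]mxE.
rewrite -/(Fop A B p K _ i).
have cv j c e := @stable_entry_series K (W K) j c e sK.
(* The partial sums are shifted by one so that their first term is [W K] and the others carry a
   factor [F]. *)
apply: cvg_lim => //; rewrite -(cvg_shiftS (series _)).
have -> : (fun n => series (fun t => iter t (F K) (W K) i a b) n.+1) =
  fun n => W K i a b + \sum_j p i j * \sum_c \sum_e (Gam A B K i c a * Gam A B K i e b)
    * series (fun t => iter t (F K) (W K) j c e) n.
  apply/funext => n; rewrite /series /= big_nat_recl //=; congr (_ + _).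
  under eq_bigr do rewrite Fop_entry.
  rewrite exchange_big /=; apply: eq_bigr => j _; rewrite -mulr_sumr; congr (_ * _).
  rewrite exchange_big /=; apply: eq_bigr => c _.
  rewrite exchange_big /=; apply: eq_bigr => e _.
  by rewrite mulr_sumr.
apply: cvgD; first exact: cvg_cst.
rewrite Fop_entry; apply: cvg_sumr => j; apply: cvgMl; apply: cvg_sumr => c.
by apply: cvg_sumr => e; apply: cvgMl; rewrite mxE; exact: cv.
Qed.

(** The difference of two solutions is fixed by [F], while its orbit tends to 0. *)
Lemma lyap_unique K P1 P2 : stable K ->
  lyap_sol A B p Q Rc K P1 -> lyap_sol A B p Q Rc K P2 -> forall i, P1 i = P2 i.
Proof.
move=> sK h1 h2.
have {}h1 i : P1 i = W K i + F K P1 i := h1 i.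
have {}h2 i : P2 i = W K i + F K P2 i := h2 i.
pose D : tuple := fun i => P1 i + (-1) *: P2 i.
have FD : F K D = D.
  rewrite FopD FopZ; apply/funext => i; rewrite /D [in RHS]h1 [in RHS]h2.
  by rewrite !scaleN1r opprD addrACA subrr add0r.
have iD n : iter n (F K) D = D by elim: n => //= n ->.
move=> i; apply/matrixP => a b; apply/eqP; rewrite -subr_eq0; apply/eqP.
have := @stable_entry0 K D i a b sK.
under eq_fun do rewrite iD.
move/cvg_lim => /(_ (@Rhausdorff R)); rewrite lim_cst //.
by rewrite /D scaleN1r !mxE.
Qed.

Local Notation PK := (PK A B p Q Rc).
Local Notation LK := (LK A B p Q Rc).

Lemma PK_lyap K : stable K -> forall i, PK K i = W K i + F K (PK K) i.
Proof.
by move=> sK; exact: (epsilon_spec (inhabits (fun _ => 0)) _ (lyap_exists sK)).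
Qed.

(** The transpose solves the same equation, so uniqueness applies. *)
Lemma PK_sym K i : stable K -> (PK K i)^T = PK K i.
Proof.
move=> sK; apply: (@lyap_unique K (fun i => (PK K i)^T)) => // [j|]; last exact: PK_lyap.
rewrite {1}PK_lyap // linearD /=; congr (_ + _).
  by rewrite linearD /= !trmx_mul trmxK (Q_posdef j).1 (R_posdef j).1 mulmxA.
rewrite /Fop !trmx_mul trmxK mulmxA; congr (_ *m _ *m _).
by rewrite /Eop linear_sum; apply: eq_bigr => l _; rewrite linearZ.
Qed.

(** The zero residual is written as a multiple by 0 so that [iterFZ] and [JZ] eliminate its
    iterates. *)
Lemma PK_residual K : stable K -> (fun i => W K i + F K (PK K) i - PK K i) = fun i => 0 *: PK K i.
Proof. by move=> sK; apply/funext => i; rewrite -PK_lyap // subrr scale0r. Qed.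

(** [PK K] equals a partial sum of [psd] terms plus [F^n (PK K)], and the latter tends to 0. *)
Lemma PK_psd K : stable K -> psdt (PK K).
Proof.
move=> sK i v; have E n : PK K i = \sum_(0 <= t < n) iter t (F K) (W K) i + iter n (F K) (PK K) i.
  have := telescope K (W K) (PK K) n i; rewrite PK_residual //.
  rewrite big1 => [/esym/eqP|t _]; last by rewrite iterFZ scale0r.
  by rewrite subr_eq0 => /eqP.
have h n : bform (iter n (F K) (PK K) i) v v <= bform (PK K i) v v.
  rewrite [in leRHS](E n) bformD lerDr bform_sum; apply: sumr_ge0 => t _.
  by apply: iterF_psd; exact: weight_psd.
apply: (@cvgr_to_le _ \oo _ _ (fun n => bform (iter n (F K) (PK K) i) v v)); last first.
  by apply: nearW => n; exact: h.
under eq_fun do rewrite bformE.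
have Z : \sum_a \sum_b 0 * (v a 0 * v b 0) = 0 :> R.
  by rewrite big1 // => a _; rewrite big1 // => b _; rewrite mul0r.
apply: (cvg_limit_eq Z); apply: cvg_sumr => a; apply: cvg_sumr => b.
by apply: cvgM; [exact: stable_entry0|exact: cvg_cst].
Qed.

Lemma JPK K : stable K -> limn (series (fun t => J (iter t (F K) (W K)))) = J (PK K).
Proof.
move=> sK; apply: cvg_lim => //.
have -> : series (fun t => J (iter t (F K) (W K))) = fun n => J (PK K) - J (iter n (F K) (PK K)).
  apply/funext => n; have := J_telescope K (W K) (PK K) n.
  rewrite PK_residual // big1 => [|t _]; last by rewrite iterFZ JZ mul0r.
  rewrite /series /=; lra.
apply: (cvg_limit_eq (subr0 _)); apply: cvgB; [exact: cvg_cst|exact: stable_J0].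
Qed.

(** By telescoping, the partial costs are at most [J P - J M]: the residual contributes [- J M] at
    time 0 and nothing positive later, and the boundary term is nonnegative. Bounded partial sums
    give stability as well. *)
Lemma supersolution K P M : psdt P -> psdt M ->
  (forall i, W K i + F K P i - P i = - M i) ->
  stable K /\ J (PK K) <= J P - J M.
Proof.
move=> hP hM E.
(* The index [n.+1] guarantees that the time 0 term, which yields [- J M], is present. *)
have h n : series (fun t => J (iter t (F K) (W K))) n.+1 <= J P - J M.
  have := J_telescope K (W K) P n.+1.
  have -> : (fun i => W K i + F K P i - P i) = fun i => (-1) *: M i.
    by apply/funext => i; rewrite E scaleN1r.
  rewrite big_nat_recl //= JZ mulN1r /series /=.
  have h1 : \sum_(0 <= t < n) J (F K (iter t (F K) (fun i => (-1) *: M i))) <= 0.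
    apply: sumr_le0 => t _; rewrite -iterS iterFZ JZ mulN1r oppr_le0.
    by apply: J_ge0; exact: iterF_psd.
  have := J_ge0 (iterF_psd K n.+1 hP) => /=; move: h1.
  set x := \sum_(0 <= t < n) _; set y := \sum_(0 <= t < n.+1) _; set z := J (F _ _).
  by lra.
have sK : stable K.
  apply: (@nonneg_series_cvg _ _ (J P - J M)) => [t|n]; first exact: stage_ge0.
  apply: le_trans (h n); rewrite /series /= [leRHS]big_nat_recr //= lerDl; exact: stage_ge0.
split => //; rewrite -JPK //; apply: limr_le => //.
exists 1%N => // -[|n] // _; exact: h.
Qed.

(** The residual plus [M] has a nonnegative sum along the orbit, so telescoping bounds the gap by
    partial sums of [M]; stability removes the boundary term in the limit. *)
Lemma subsolution K P M : stable K -> psdt (fun i => W K i + F K P i - P i + M i) ->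
  J P - J (PK K) <= limn (series (fun t => J (iter t (F K) M))).
Proof.
move=> sK hE; rewrite lerBlDr -JPK //.
have c1 := @stable_J_series K M sK.
have h n : J P - J (iter n (F K) P) <= series (fun t => J (iter t (F K) M)) n
    + series (fun t => J (iter t (F K) (W K))) n.
  have := J_telescope K (W K) P n.
  set E := (fun i => _ - P i).
  have : 0 <= \sum_(0 <= t < n) J (iter t (F K) (fun i => E i + M i)).
    by apply: sumr_ge0 => t _; apply: J_ge0; exact: iterF_psd.
  under eq_bigr do rewrite iterFD JD.
  rewrite big_split /= /series /=; lra.
apply: (@ler_cvg_to _ \oo _ _ (fun n => J P - J (iter n (F K) P))).
- apply: (cvg_limit_eq (subr0 _)); apply: cvgB; [exact: cvg_cst|exact: stable_J0].
- by apply: cvgD; [exact: c1|exact: sK].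
- by apply: nearW => n; exact: h.
Qed.

(** * Duality between [Fop] and [Top] *)

Lemma Top_adjoint K (X V : tuple) :
  \sum_i \tr (X i *m F K V i) = \sum_j \tr (Top A B p K X j *m V j).
Proof.
under eq_bigr => i _.
  rewrite /Fop /Eop mulmx_sumr mulmx_suml mulmx_sumr linear_sum /=.
  under eq_bigr => j _.
    rewrite -scalemxAr -scalemxAl -scalemxAr linearZ /= mulmxA mxtrace_mulC !mulmxA.
    over.
  over.
rewrite exchange_big /=; apply: eq_bigr => j _.
rewrite mulmx_suml linear_sum /=; apply: eq_bigr => i _.
by rewrite -scalemxAl linearZ.
Qed.

Lemma iter_Top_adjoint K (X V : tuple) t :
  \sum_i \tr (X i *m iter t (F K) V i) = \sum_j \tr (iter t (Top A B p K) X j *m V j).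
Proof.
by elim: t X => // t IH X; rewrite iterS Top_adjoint IH -iterSr.
Qed.

Lemma J_iter_Top K V t : J (iter t (F K) V) =
  \sum_j \tr (iter t (Top A B p K) (fun i => pi i *: S) j *m V j).
Proof.
rewrite -iter_Top_adjoint; apply: eq_bigr => i _.
by rewrite -scalemxAl linearZ.
Qed.

(** Entries of the iterates of [Top] are values of [J] along orbits of matrix units. Their series
    therefore converge by stability, and the limit passes through the trace. *)
Lemma limn_J K M : stable K -> limn (series (fun t => J (iter t (F K) M))) =
  \sum_i \tr ((\matrix_(a, b) limn (series (fun t =>
      iter t (Top A B p K) (fun i => pi i *: S) i a b))) *m M i).
Proof.
move=> sK.
have entry t i a b : iter t (Top A B p K) (fun i => pi i *: S) i a b
    = J (iter t (F K) (fun j => (i == j)%:R *: delta_mx b a)).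
  rewrite J_iter_Top (bigD1 i) //= eqxx scale1r big1 ?addr0 => [|j /negbTE ji].
    rewrite /mxtrace (bigD1 a) //= mxE (bigD1 b) //= !mxE !eqxx mulr1.
    rewrite big1 ?addr0 => [|c /negbTE cb]; last by rewrite mxE cb mulr0.
    rewrite big1 ?addr0 // => c /negbTE ca; rewrite mxE big1 // => e _.
    by rewrite mxE ca andbF mulr0.
  by rewrite eq_sym ji scale0r mulmx0 linear0.
apply: cvg_lim => //.
have -> : series (fun t => J (iter t (F K) M)) = fun n => \sum_i \sum_a \sum_b
    (M i b a * series (fun t => iter t (Top A B p K) (fun i => pi i *: S) i a b) n).
  apply/funext => n; rewrite /series /=.
  under eq_bigr do rewrite J_iter_Top.
  rewrite exchange_big /=; apply: eq_bigr => i _; rewrite /mxtrace.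
  rewrite exchange_big /=; apply: eq_bigr => a _.
  under eq_bigr do rewrite mxE.
  rewrite exchange_big /=; apply: eq_bigr => b _; rewrite mulr_sumr.
  by apply: eq_bigr => t _; rewrite mulrC.
apply: cvg_sumr => i; rewrite /mxtrace; apply: cvg_sumr => a; rewrite mxE.
apply: cvg_sumr => b; rewrite mulrC mxE; apply: cvgMl.
have -> : (fun t => iter t (Top A B p K) (fun i => pi i *: S) i a b)
    = fun t => J (iter t (F K) (fun j => (i == j)%:R *: delta_mx b a)).
  by apply/funext.
exact: stable_J_series.
Qed.

(** * Gauss-Newton steps *)

Definition hess K i : 'M[R]_k := Rc i + (B i)^T *m Eop p (PK K) i *m B i.
(** Completing the square in [D] shows that minus this matrix is the least value of the quadratic
    residual in [residual_shift]. *)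
Definition gn_decrement K : @mtuple R Ns d :=
  fun i => (LK K i)^T *m invmx (hess K i) *m LK K i.

Lemma Eop_sym K i : stable K -> (Eop p (PK K) i)^T = Eop p (PK K) i.
Proof.
move=> sK; rewrite /Eop linear_sum; apply: eq_bigr => j _ /=.
by rewrite linearZ /= PK_sym.
Qed.

Lemma hess_posdef K i : stable K -> posdef (hess K i).
Proof.
move=> sK; split.
  by rewrite linearD /= !trmx_mul trmxK Eop_sym // (R_posdef i).1 mulmxA.
move=> v v0; rewrite -/(bform _ _ _) bformD ltr_wpDr //; last exact: (R_posdef i).2.
apply: psd_congr; apply: psd_sum => j; apply: psd_scale => //.
exact: (PK_psd sK).
Qed.

Lemma gn_decrement_sym K i : stable K -> (gn_decrement K i)^T = gn_decrement K i.
Proof.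
move=> sK; rewrite /gn_decrement !trmx_mul trmxK mulmxA.
by have [-> _] := posdef_inv (hess_posdef i sK).
Qed.

Lemma gn_decrement_psd K : stable K -> psdt (gn_decrement K).
Proof.
move=> sK i; apply: psd_congr; apply: posdef_psd; apply: posdef_inv; exact: hess_posdef.
Qed.

(** The Lyapunov equation of [K] cancels the terms free of [D]; symmetry of [R] and [E(P)] then
    gathers the linear terms into [L]. *)
Lemma residual_shift K K' (D : 'M[R]_(k, d)) i : stable K -> K' i = K i + D ->
  W K' i + F K' (PK K) i - PK K i =
  D^T *m LK K i + (LK K i)^T *m D + D^T *m hess K i *m D.
Proof.
move=> sK eK.
rewrite (PK_lyap sK).
apply: mx_bform_inj => u v; rewrite /weight /Fop /Gam eK.
have sE x y : bform (Eop p (PK K) i) x y = bform (Eop p (PK K) i) y x.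
  by rewrite -bform_tr Eop_sym.
have sR x y : bform (Rc i) x y = bform (Rc i) y x by rewrite -bform_tr (R_posdef i).1.
have opp m n (M : 'M[R]_(m, n)) x y : bform M (- x) y = - bform M x y.
  by rewrite -scaleN1r bformZl mulN1r.
have oppr m n (M : 'M[R]_(m, n)) x y : bform M x (- y) = - bform M x y.
  by rewrite -scaleN1r bformZr mulN1r.
have hL x y : bform (LK K i) x y = bform (Rc i) x (K i *m y)
    + bform (Eop p (PK K) i) (B i *m x) (B i *m (K i *m y))
    - bform (Eop p (PK K) i) (B i *m x) (A i *m y).
  by rewrite /LK bformB bform_mul bform_mulr bformD bform_mul.
rewrite !(bformD, bformN) (bform_trmul (LK K i)) bform_mull !hL !bform_mul /hess !bformD !bform_mul.
rewrite !(mulmxBl, mulmxDl, mulmxDr) -!mulmxA !(bformDl, bformDr, opp, oppr).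
rewrite (sR (D *m v)) (sE (B i *m (D *m v)) (A i *m u)).
rewrite (sE (B i *m (D *m v)) (B i *m (K i *m u))).
by ring.
Qed.

(** With [D = - 2 eta G^-1 L], the two linear terms contribute [- 4 eta] and the quadratic one
    [4 eta^2] times the decrement. *)
Lemma residual_gn K K' eta i : stable K ->
  K' i = K i - (2 * eta) *: (invmx (hess K i) *m LK K i) ->
  W K' i + F K' (PK K) i - PK K i = - ((4 * eta * (1 - eta)) *: gn_decrement K i).
Proof.
move=> sK eK; rewrite (residual_shift sK eK).
have pG := hess_posdef i sK; have uG := posdef_unit pG.
have [sGi _] := posdef_inv pG.
have GG : (LK K i)^T *m (invmx (hess K i) *m hess K i) *m invmx (hess K i) *m LK K i = gn_decrement K i.
  by rewrite mulVmx // mulmx1.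
rewrite -scaleNr linearZ /= trmx_mul sGi -!(scalemxAl, scalemxAr) scalerA.
rewrite -!mulmxA in GG; rewrite -!mulmxA GG /gn_decrement -!mulmxA.
by rewrite -[RHS]scaleNr -!scalerDl; congr (_ *: _); ring.
Qed.

Lemma gn_step K K' eta : stable K -> 0 < eta -> eta <= 1 / 2 ->
  (forall i, K' i = K i - (2 * eta) *: (invmx (hess K i) *m LK K i)) ->
  stable K' /\ J (PK K') <= J (PK K) - 4 * eta * (1 - eta) * J (gn_decrement K).
Proof.
move=> sK e0 e1 eK; rewrite -JZ; apply: supersolution => //.
- exact: (PK_psd sK).
- by move=> i; apply: psd_scale; [nra|exact: gn_decrement_psd].
- by move=> i; exact: residual_gn.
Qed.

Lemma gradient_dominance K Kst : stable K -> stable Kst ->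
  J (PK K) - J (PK Kst) <=
  \sum_i \tr ((\matrix_(a, b) limn (series (fun t =>
      iter t (Top A B p Kst) (fun i => pi i *: S) i a b))) *m gn_decrement K i).
Proof.
move=> sK sKst; rewrite -(limn_J (gn_decrement K) sKst).
apply: subsolution => // i v.
rewrite (@residual_shift K Kst (Kst i - K i)) //; last by rewrite addrC subrK.
set D := Kst i - K i; have pG := hess_posdef i sK; have uG := posdef_unit pG.
(* The form of [G] at [D v + G^-1 L v] is the completed square, equal to the residual plus the
   decrement. *)
have := posdef_psd pG (D *m v + invmx (hess K i) *m (LK K i *m v)).
congr (0 <= _); have [sGi _] := posdef_inv pG.
have E1 x : bform (hess K i) x (invmx (hess K i) *m (LK K i *m v)) = bform (LK K i) x v.
  by rewrite -!bform_mulr mulmxV // mul1mx.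
have E2 x y : bform (hess K i) x y = bform (hess K i) y x by rewrite -bform_tr pG.1.
have E3 : bform (LK K i) (invmx (hess K i) *m (LK K i *m v)) v
    = bform (invmx (hess K i)) (LK K i *m v) (LK K i *m v).
  by have := bform_mull (LK K i) (invmx (hess K i)) (LK K i *m v) v; rewrite sGi bform_mulr => <-.
rewrite bformDl !bformDr !E1 [bform (hess K i) (invmx _ *m _) (D *m v)]E2 E1 E3.
rewrite [in RHS]bformD [in RHS]bformD [in RHS]bformD (bform_trmul (LK K i)) bform_mull !bform_mul.
by ring.
Qed.

End Lyapunov.

(** * Linear convergence of the iterates *)

Theorem theorem2 (R : realType) (Ns d k : nat)
  (A : 'I_Ns -> 'M[R]_d) (B : 'I_Ns -> 'M[R]_(d, k))
  (p : 'I_Ns -> 'I_Ns -> R) (pi : 'I_Ns -> R)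
  (Q : 'I_Ns -> 'M[R]_d) (Rc : 'I_Ns -> 'M[R]_k)
  (dT : measure_display) (T : measurableType dT) (P : probability T R)
  (omega : nat -> T -> 'I_Ns) (x0 : T -> 'cV[R]_d)
  (K0 Kst : @gain R Ns d k) (eta : R) :
  (0 < Ns)%N ->
  (* transition probabilities and initial distribution *)
  (forall i j, 0 <= p i j) -> (forall i, \sum_j p i j = 1) ->
  (forall i, 0 < pi i) -> \sum_i pi i = 1 ->
  (* omega is a time-homogeneous Markov chain with law (pi, p) *)
  (forall t i, measurable [set w | omega t w = i]) ->
  (forall n (s : nat -> 'I_Ns),
      P (cyl omega n s) = (pi (s 0%N) * \prod_(t < n) p (s t) (s t.+1))%:E) ->
  (* x0 is a random vector, square integrable, independent of the chain *)
  (forall a, measurable_fun setT (fun w => x0 w a ord0)) ->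
  (forall a, (\int[P]_w ((x0 w a ord0) ^+ 2)%:E < +oo)%E) ->
  (forall (Bs : 'I_d -> set R), (forall a, measurable (Bs a)) ->
     forall n (s : nat -> 'I_Ns),
     P ([set w | forall a, Bs a (x0 w a ord0)] `&` cyl omega n s)
     = (P [set w | forall a, Bs a (x0 w a ord0)] * P (cyl omega n s))%E) ->
  posdef (Sigma0 P x0) ->
  (* cost weights *)
  (forall i, posdef (Q i)) -> (forall i, posdef (Rc i)) ->
  (* mean-square stabilizability *)
  (exists K, Kset A B Q Rc P omega x0 K) ->
  (* K* is an optimal gain *)
  Kset A B Q Rc P omega x0 Kst ->
  (forall K, Kset A B Q Rc P omega x0 K ->
     (cost A B Q Rc P omega x0 Kst <= cost A B Q Rc P omega x0 K)%E) ->
  (* Gauss--Newton *)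
  Kset A B Q Rc P omega x0 K0 ->
  0 < eta -> eta <= 1 / 2 ->
  let mu := inf (range (fun i => pi i * sigma_min (Sigma0 P x0))) in
  let Xn := maxnorm (XK A B p P omega x0 Kst) in
  forall n : nat,
    Kset A B Q Rc P omega x0 (GN A B p Q Rc eta K0 n) /\
    (cost A B Q Rc P omega x0 (GN A B p Q Rc eta K0 n) - cost A B Q Rc P omega x0 Kst
     <= ((1 - 2 * mu / Xn * eta) ^+ n)%:E
        * (cost A B Q Rc P omega x0 K0 - cost A B Q Rc P omega x0 Kst))%E.
Proof.
move=> Ns0 p0 _ pi0 _ om_meas om_law x0_meas x0_sq x0_ind S_pos Q_pos R_pos _ Kst_in Kst_opt K0_in e0 e1.
move=> mu Xn.
set S := Sigma0 P x0 in S_pos mu *.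
pose st := stable A B p pi Q Rc S.
pose c K := Jcost pi S (PK A B p Q Rc K).
have costE K : cost A B Q Rc P omega x0 K =
    (\sum_(t <oo) (Jcost pi S (iter t (Fop A B p K) (weight Q Rc K)))%:E)%E.
  by apply: costE => // i; exact: weight_psd.
have s0 K t : 0 <= Jcost pi S (iter t (Fop A B p K) (weight Q Rc K)) by exact: stage_ge0.
have inE K : Kset A B Q Rc P omega x0 K <-> st K.
  split; rewrite /Kset /= costE; first exact: ereal_series_cvgP.
  by move=> sK; rewrite ereal_series_cvg // ltry.
have cE K : st K -> cost A B Q Rc P omega x0 K = (c K)%:E.
  by move=> sK; rewrite costE ereal_series_cvg // JPK.
have sKst : st Kst by apply/inE.
have opt K : st K -> c Kst <= c K.
  by move=> sK; have := Kst_opt K ((inE K).2 sK); rewrite (cE _ sKst) (cE _ sK) lee_fin.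
have mu_le i : mu <= pi i * sigma_min S.
  apply: ge_inf; last by exists i.
  by exists 0 => _ [j _ <-]; rewrite mulr_ge0 ?sigma_min_ge0 // ltW.
have mu0 : 0 <= mu.
  apply: lb_le_inf; first by exists (pi (Ordinal Ns0) * sigma_min S), (Ordinal Ns0).
  by move=> _ [j _ <-]; rewrite mulr_ge0 ?sigma_min_ge0 // ltW.
have X0f : X0 P omega x0 = fun i => pi i *: S by apply/funext => i; exact: X0E.
have Xn_ge i : specnorm (XK A B p P omega x0 Kst i) <= Xn.
  by apply: (le_bigmax _ (fun i => specnorm _) i).
have Xn0 : 0 <= Xn by exact: bigmax_ge_id.
set f := 1 - 2 * mu / Xn * eta.
(* One step: the decrease is at least [2 eta mu m] and the gap at most [Xn * m], where [m] is the
   total trace of the decrement; eliminating [m] gives the factor [f]. *)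
have step K K' : st K ->
    (forall i, K' i = K i - (2 * eta) *: (invmx (hess A B p Q Rc K i) *m LK A B p Q Rc K i)) ->
    [/\ st K', c K' <= c K & c K' - c Kst <= f * (c K - c Kst)].
  move=> sK eK.
  have [sK' dec] := gn_step p0 pi0 S_pos Q_pos R_pos sK e0 e1 eK.
  have dom := gradient_dominance p0 pi0 S_pos Q_pos R_pos sK sKst.
  set M := gn_decrement A B p Q Rc K in dec dom.
  have sM i : (M i)^T = M i := gn_decrement_sym p0 pi0 S_pos Q_pos R_pos i sK.
  have hM : psdt M := gn_decrement_psd p0 pi0 S_pos Q_pos R_pos sK.
  pose m := \sum_i \tr (M i).
  have Jm : mu * m <= Jcost pi S M.
    rewrite mulr_sumr; apply: ler_sum => i _; rewrite -mxtraceZ scalemxAl.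
    apply: tr_mul_ge => // v; rewrite bformZ.
    apply: (@le_trans _ _ (pi i * (sigma_min S * sqnorm v))).
      by rewrite mulrA ler_wpM2r ?sqnorm_ge0.
    by rewrite ler_wpM2l ?psd_sigma_min ?S_pos.1 //; [exact: ltW|exact: posdef_psd].
  have dm : c K - c Kst <= Xn * m.
    apply: le_trans dom _; rewrite mulr_sumr; apply: ler_sum => i _.
    apply: tr_mul_le => // v; apply: le_trans (bform_specnorm _ _) _.
    by rewrite ler_wpM2r ?sqnorm_ge0 // -X0f; exact: Xn_ge.
  have m0 : 0 <= m.
    by apply: sumr_ge0 => i _; apply: sumr_ge0 => a _; rewrite -bform_delta; exact: hM.
  have JM0 : 0 <= Jcost pi S M by apply: le_trans Jm; rewrite mulr_ge0.
  (* Here [eta <= 1 / 2] gives [4 eta (1 - eta) >= 2 eta]. *)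
  have d1 : c K' <= c K - 2 * eta * (mu * m).
    apply: le_trans dec _; rewrite lerD2l lerN2.
    apply: (@le_trans _ _ (2 * eta * Jcost pi S M)).
      by rewrite ler_wpM2l // mulr_ge0 // ltW.
    by rewrite ler_wpM2r //; nra.
  split => //; first by apply: le_trans d1 _; rewrite gerBl !mulr_ge0 // ltW.
  (* Division by 0 yields 0, so [f = 1] in this case and monotone decrease suffices. *)
  have [X0|Xnz] := eqVneq Xn 0.
    rewrite /f X0 invr0 mulr0 mul0r subr0 mul1r lerD2r.
    by apply: le_trans d1 _; rewrite gerBl !mulr_ge0 // ltW.
  have Xp : 0 < Xn by rewrite lt_neqAle eq_sym Xnz.
  have h : (c K - c Kst) / Xn <= m by rewrite ler_pdivrMr // mulrC.
  rewrite /f mulrBl mul1r -[X in _ <= _ - X](_ : 2 * eta * (mu * ((c K - c Kst) / Xn)) = _); last by field.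
  rewrite lerBlDr addrAC subrK (le_trans d1) // lerD2l lerN2.
  by rewrite ler_wpM2l ?mulr_ge0 ?ler_wpM2l // ltW.
pose g := GN A B p Q Rc eta K0.
have stg n : st (g n).
  elim: n => [|n IH]; first exact/inE.
  (* The recursion defining [GN] matches the step formula by computation. *)
  by have [] := step (g n) (g n.+1) IH (fun i => erefl).
have dec n : c (g n.+1) <= c (g n) by have [] := step (g n) (g n.+1) (stg n) (fun i => erefl).
have con n : c (g n.+1) - c Kst <= f * (c (g n) - c Kst).
  by have [] := step (g n) (g n.+1) (stg n) (fun i => erefl).
move=> n; split; first exact: (inE _).2 (stg n).
have sg0 : st K0 := stg 0%N.
have sgn : st (GN A B p Q Rc eta K0 n) := stg n.
rewrite !cE // -!EFinB -EFinM lee_fin -/(g n).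
have c0 : c Kst <= c K0 by exact: opt.
(* If the initial gap is 0, the right-hand side vanishes whatever the sign of [f], and monotone
   decrease concludes. *)
have [eq0|ne0] := eqVneq (c K0) (c Kst).
  have le0 : c (g n) <= c K0.
    by elim: {sgn} n => [|n IH]; [exact: lexx|exact: le_trans (dec n) IH].
  by rewrite eq0 subrr mulr0 subr_le0 -eq0.
(* The contraction itself forces a nonnegative rate as long as [K0] is not optimal. *)
have f0 : 0 <= f.
  have gap : 0 < c K0 - c Kst by rewrite subr_gt0 lt_neqAle eq_sym ne0.
  rewrite -(pmulr_lge0 f gap); apply: le_trans (con 0%N).
  by rewrite subr_ge0; exact: opt (stg 1%N).
elim: {sgn} n => [|n IH]; first by rewrite expr0 mul1r.
by apply: le_trans (con n) _; rewrite exprS -mulrA ler_wpM2l.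
Qed.
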